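(* Let $g\in H(\mathbb D)$, $\alpha\geq0$ and $\beta>0$. Then $S_g: H^{\infty}_\alpha\rightarrow H^{\infty}_\beta$ is bounded if and only if $$\sup_{z\in\mathbb D}(1-|z|^2)^{\beta-\alpha}|g(z)|<\infty\,.$$
   Context: $\mathbb D$ is the open unit disk and $H(\mathbb D)$ the space of analytic functions on $\mathbb D$. For $\alpha\geq0$, $H^{\infty}_\alpha=\{f\in H(\mathbb D): \|f\|_{H^\infty_\alpha}:=\sup_{z\in\mathbb D}(1-|z|^2)^\alpha|f(z)|<\infty\}$. For $g\in H(\mathbb D)$, $(S_gf)(z)=\int_0^z f'(\omega)g(\omega)\,d\omega$. *)

(* Defs.v *)
From Stdlib Require Import Reals Lra.
Open Scope R_scope.

Definition Cpx : Type := (R * R)%type.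
Definition Cadd (z w : Cpx) : Cpx := (fst z + fst w, snd z + snd w).
Definition Csub (z w : Cpx) : Cpx := (fst z - fst w, snd z - snd w).
Definition Cmul (z w : Cpx) : Cpx :=
  (fst z * fst w - snd z * snd w, fst z * snd w + snd z * fst w).
Definition Cscal (t : R) (z : Cpx) : Cpx := (t * fst z, t * snd z).
Definition Cnorm (z : Cpx) : R := sqrt (fst z * fst z + snd z * snd z).

Definition inD (z : Cpx) : Prop := Cnorm z < 1.

Definition Cderiv (f : Cpx -> Cpx) (z : Cpx) (d : Cpx) : Prop :=
  forall eps : R, 0 < eps -> exists delta : R, 0 < delta /\
    forall h : Cpx, Cnorm h < delta ->
      Cnorm (Csub (Csub (f (Cadd z h)) (f z)) (Cmul d h)) <= eps * Cnorm h.

Definition HD (f : Cpx -> Cpx) : Prop :=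
  forall z : Cpx, inD z -> exists d : Cpx, Cderiv f z d.

(* (1-|z|^2)^a, a real exponent (base > 0 on the disk) *)
Definition weight (a : R) (z : Cpx) : R := Rpower (1 - Cnorm z ^ 2) a.

Definition Hinf_bound (a : R) (f : Cpx -> Cpx) (N : R) : Prop :=
  forall z : Cpx, inD z -> weight a z * Cnorm (f z) <= N.

Definition Hinf (a : R) (f : Cpx -> Cpx) : Prop :=
  HD f /\ exists N : R, Hinf_bound a f N.

(* Line integral along the segment [0,z]:
   I = int_0^z h(w) dw = int_0^1 h(t z) z dt  (real and imaginary parts as
   Riemann integrals). *)
Definition seg_int (h : Cpx -> Cpx) (z : Cpx) (I : Cpx) : Prop :=
  exists (pr1 : Riemann_integrable (fun t => fst (Cmul (h (Cscal t z)) z)) 0 1)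
         (pr2 : Riemann_integrable (fun t => snd (Cmul (h (Cscal t z)) z)) 0 1),
    RiemannInt pr1 = fst I /\ RiemannInt pr2 = snd I.

Definition Sg (g f F : Cpx -> Cpx) : Prop :=
  exists fp : Cpx -> Cpx,
    (forall w : Cpx, inD w -> Cderiv f w (fp w)) /\
    (forall z : Cpx, inD z -> seg_int (fun w => Cmul (fp w) (g w)) z (F z)).

Definition Sg_bounded (g : Cpx -> Cpx) (a b : R) : Prop :=
  exists K : R,
    forall f : Cpx -> Cpx, Hinf a f ->
      forall F : Cpx -> Cpx, Sg g f F ->
        HD F /\ forall N : R, Hinf_bound a f N -> Hinf_bound b F (K * N).

(* Main.v *)
(* If |f| (1-|z|^2)^alpha <= N, the Cauchy estimate on the disc of radius (1-|a|)/2 about a gives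
   |f'(a)| (1-|a|^2)^(alpha+1) <= C N.  With the condition on g this bounds the integrand f' g by
   a multiple of (1-|w|^2)^(-beta-1), and integrating along the ray [0,z] gains one power.
   Conversely, (S_g f)' = f' g, so the same estimate applied to S_g f, with f a disc automorphism
   vanishing at a times (1-|a|^2)^(m-alpha) / (1 - conj(a) w)^m, for which
   |f'(a)| = (1-|a|^2)^(-alpha-1), bounds g at a.

   Differentiability is only pointwise, so Cauchy's theorem is proved by Goursat's bisection,
   for the pullback of f(w) dw to the unit square under a smooth map: a degenerate square
   gives triangles (hence primitives), and a homotopy of circles gives the Cauchy formula. *)
Require Import Defs.
From Stdlib Require Import Reals Lra Lia Classical ClassicalEpsilon FunctionalExtensionality.
From Coquelicot Require Import Coquelicot.
Open Scope R_scope.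

(** * Curves in the complex plane *)

(** Membership in [HD] gives no continuity of the derivative, while both the existence of the ray
    integrals in [Sg] and their being primitives rest on the regularity of f' g. This is what calls
    for the Cauchy formula: it writes f' locally as an integral of f against a squared kernel, which
    can be differentiated once more, so f' is again in [HD]. Maps of a square, rather than domains,
    carry Cauchy's theorem, so that no winding number or decomposition of paths occurs; only the map
    changes from one use to the next. The weights of the two implications match through beta + 1 =
    (alpha + 1) + (beta - alpha): one summand is absorbed by f', the other is the condition on g.
    The positivity of beta enters where (1 - t rho)^(-beta-1) is integrated: the primitive carries a
    factor 1 / beta, and at beta = 0 it would be a logarithm. *)

Lemma Cnorm_Cmod (z : C) : Cnorm z = Cmod z.
Proof. unfold Cnorm, Cmod. f_equal. ring. Qed.

Lemma CderivE (f : C -> C) (z d : C) :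
  Cderiv f z d <->
  forall eps, 0 < eps -> exists delta, 0 < delta /\ forall h : C, Cmod h < delta ->
    Cmod (f (z + h) - f z - d * h)%C <= eps * Cmod h.
Proof.
  unfold Cderiv; split; intros H eps He; destruct (H eps He) as [de [Hd Hh]];
    exists de; split; auto; intros h Hc.
  - rewrite <- !Cnorm_Cmod. apply Hh. now rewrite Cnorm_Cmod.
  - rewrite !Cnorm_Cmod. apply Hh. now rewrite <- Cnorm_Cmod.
Qed.

Lemma Cmod_fst (z : C) : Rabs (fst z) <= Cmod z.
Proof. apply Rle_trans with (2 := Rmax_Cmod z). apply Rmax_l. Qed.

Lemma Cmod_snd (z : C) : Rabs (snd z) <= Cmod z.
Proof. apply Rle_trans with (2 := Rmax_Cmod z). apply Rmax_r. Qed.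

Lemma Cmod_le_abs (z : C) : Cmod z <= Rabs (fst z) + Rabs (snd z).
Proof.
  unfold Cmod. rewrite <- (Rabs_pos_eq (Rabs _ + Rabs _)).
  2: { generalize (Rabs_pos (fst z)) (Rabs_pos (snd z)); lra. }
  rewrite <- sqrt_Rsqr_abs. apply sqrt_le_1_alt. unfold Rsqr.
  rewrite <- (pow2_abs (fst z)), <- (pow2_abs (snd z)).
  generalize (Rabs_pos (fst z)) (Rabs_pos (snd z)); nra.
Qed.

Lemma Cmod_minus_sym (x y : C) : Cmod (x - y)%C = Cmod (y - x)%C.
Proof. rewrite <- Cmod_opp. f_equal. ring. Qed.

Lemma Cmod_triangle_rev (x y : C) : Cmod x - Cmod y <= Cmod (x - y)%C.
Proof.
  generalize (Cmod_triangle (x - y)%C y). replace (x - y + y)%C with x by ring. lra.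
Qed.

Lemma Cmod_triangle_minus (x y : C) : Cmod (x - y)%C <= Cmod x + Cmod y.
Proof. unfold Cminus. rewrite <- (Cmod_opp y). apply Cmod_triangle. Qed.

Lemma Cmod_Rmult (t : R) (z : C) : 0 <= t -> Cmod (RtoC t * z)%C = t * Cmod z.
Proof. intros H. rewrite Cmod_mult, Cmod_R, Rabs_pos_eq; auto. Qed.

(** Working by coordinates gives access to the real calculus, and it matches [seg_int], which is
    stated through real and imaginary parts. *)
Definition ccont (u : R -> C) (t : R) : Prop :=
  continuous (fun s => fst (u s)) t /\ continuous (fun s => snd (u s)) t.

Definition cder (u : R -> C) (t : R) (v : C) : Prop :=
  is_derive (fun s => fst (u s)) t (fst v) /\ is_derive (fun s => snd (u s)) t (snd v).

Definition cint (u : R -> C) (a b : R) (l : C) : Prop :=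
  is_RInt (fun s => fst (u s)) a b (fst l) /\ is_RInt (fun s => snd (u s)) a b (snd l).

Definition CI (u : R -> C) (a b : R) : C :=
  (RInt (fun s => fst (u s)) a b, RInt (fun s => snd (u s)) a b).

Lemma continuous_eps (u : R -> R) (t : R) :
  continuous u t <->
  forall eps, 0 < eps -> exists delta, 0 < delta /\
    forall s, Rabs (s - t) < delta -> Rabs (u s - u t) < eps.
Proof.
  split.
  - intros H eps He.
    destruct (proj1 (filterlim_locally u (u t)) H (mkposreal eps He)) as [d Hd].
    exists d. split; [apply cond_pos|]. intros s Hs. apply (Hd s), Hs.
  - intros H. apply (proj2 (filterlim_locally u (u t))). intros [eps He].
    destruct (H eps He) as [d [Hd Hs]]. exists (mkposreal d Hd).
    intros s Hb. apply Hs, Hb.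
Qed.

Lemma ccont_eps (u : R -> C) (t : R) :
  ccont u t <->
  forall eps, 0 < eps -> exists delta, 0 < delta /\
    forall s, Rabs (s - t) < delta -> Cmod (u s - u t)%C < eps.
Proof.
  unfold ccont. rewrite !continuous_eps. split.
  - intros [H1 H2] eps He.
    destruct (H1 (eps / 2)) as [d1 [Hd1 K1]]; [lra|].
    destruct (H2 (eps / 2)) as [d2 [Hd2 K2]]; [lra|].
    exists (Rmin d1 d2). split; [now apply Rmin_pos|]. intros s Hs.
    apply Rle_lt_trans with (1 := Cmod_le_abs _).
    generalize (K1 s (Rlt_le_trans _ _ _ Hs (Rmin_l _ _)))
               (K2 s (Rlt_le_trans _ _ _ Hs (Rmin_r _ _))).
    simpl. unfold Rminus. lra.
  - intros H. split; intros eps He; destruct (H eps He) as [d [Hd K]];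
      exists d; split; auto; intros s Hs.
    + apply Rle_lt_trans with (2 := K s Hs). apply (Cmod_fst (u s - u t)%C).
    + apply Rle_lt_trans with (2 := K s Hs). apply (Cmod_snd (u s - u t)%C).
Qed.

Lemma ccont_const (c : C) (t : R) : ccont (fun _ => c) t.
Proof. split; apply continuous_const. Qed.

Lemma ccont_plus (u v : R -> C) (t : R) :
  ccont u t -> ccont v t -> ccont (fun s => u s + v s)%C t.
Proof.
  intros [A B] [D E]; split; simpl.
  - now apply (continuous_plus (V := R_NormedModule) (fun s => fst (u s)) (fun s => fst (v s))).
  - now apply (continuous_plus (V := R_NormedModule) (fun s => snd (u s)) (fun s => snd (v s))).
Qed.

Lemma ccont_mult (u v : R -> C) (t : R) :
  ccont u t -> ccont v t -> ccont (fun s => u s * v s)%C t.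
Proof.
  intros [A B] [D E]; split; simpl.
  - apply (continuous_minus (V := R_NormedModule)
      (fun s => fst (u s) * fst (v s)) (fun s => snd (u s) * snd (v s)));
      now apply (continuous_mult (K := R_AbsRing)).
  - apply (continuous_plus (V := R_NormedModule)
      (fun s => fst (u s) * snd (v s)) (fun s => snd (u s) * fst (v s)));
      now apply (continuous_mult (K := R_AbsRing)).
Qed.

Lemma ccont_opp (u : R -> C) (t : R) : ccont u t -> ccont (fun s => - u s)%C t.
Proof.
  intros [A B]; split; simpl.
  - now apply (continuous_opp (V := R_NormedModule) (fun s => fst (u s))).
  - now apply (continuous_opp (V := R_NormedModule) (fun s => snd (u s))).
Qed.

Lemma ccont_minus (u v : R -> C) (t : R) :
  ccont u t -> ccont v t -> ccont (fun s => u s - v s)%C t.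
Proof. intros H K. apply ccont_plus; auto. now apply ccont_opp. Qed.

Lemma Cderiv_cont (f : C -> C) (z d : C) :
  Cderiv f z d -> forall eps, 0 < eps -> exists delta, 0 < delta /\
    forall w : C, Cmod (w - z)%C < delta -> Cmod (f w - f z)%C < eps.
Proof.
  intros H eps He. destruct (proj1 (CderivE f z d) H 1 Rlt_0_1) as [de [Hd K]].
  generalize (Cmod_ge_0 d); intros Hd0.
  exists (Rmin de (eps / (2 + Cmod d))).
  assert (Hq : 0 < eps / (2 + Cmod d)) by (apply Rdiv_lt_0_compat; lra).
  split; [now apply Rmin_pos|]. intros w Hw.
  assert (K' := K (w - z)%C (Rlt_le_trans _ _ _ Hw (Rmin_l _ _))).
  assert (Hw2 := Rlt_le_trans _ _ _ Hw (Rmin_r _ _)).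
  replace (z + (w - z))%C with w in K' by ring.
  replace (f w - f z)%C with ((f w - f z - d * (w - z)) + d * (w - z))%C by ring.
  apply Rle_lt_trans with (1 := Cmod_triangle _ _).
  rewrite Cmod_mult.
  apply Rmult_lt_compat_r with (r := 2 + Cmod d) in Hw2; [|lra].
  replace (eps / (2 + Cmod d) * (2 + Cmod d)) with eps in Hw2 by (field; lra).
  generalize (Cmod_ge_0 (w - z)%C). nra.
Qed.

Lemma ccont_comp (f : C -> C) (u : R -> C) (t : R) (d : C) :
  Cderiv f (u t) d -> ccont u t -> ccont (fun s => f (u s)) t.
Proof.
  rewrite !ccont_eps. intros H K eps He.
  destruct (Cderiv_cont _ _ _ H eps He) as [d1 [Hd1 K1]].
  destruct (K d1 Hd1) as [d2 [Hd2 K2]]. exists d2; split; auto.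
Qed.

Lemma cder_ccont (u : R -> C) (t : R) (v : C) : cder u t v -> ccont u t.
Proof.
  intros [A B]; split; apply (ex_derive_continuous (V := R_NormedModule)); eexists; eauto.
Qed.

Lemma cder_eq (u : R -> C) (t : R) (v w : C) : cder u t v -> v = w -> cder u t w.
Proof. now intros H <-. Qed.

Lemma cder_const (c : C) (t : R) : cder (fun _ => c) t (RtoC 0).
Proof. split; apply (is_derive_const (V := R_NormedModule)). Qed.

Lemma cder_id (t : R) : cder (fun s => RtoC s) t (RtoC 1).
Proof. split; simpl; [apply (is_derive_id (K := R_AbsRing)) | apply (is_derive_const (V := R_NormedModule))]. Qed.

Lemma cder_plus (u v : R -> C) (t : R) (du dv : C) :
  cder u t du -> cder v t dv -> cder (fun s => u s + v s)%C t (du + dv)%C.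
Proof.
  intros [A B] [D E]; split; simpl.
  - now apply (is_derive_plus (V := R_NormedModule) (fun s => fst (u s)) (fun s => fst (v s))).
  - now apply (is_derive_plus (V := R_NormedModule) (fun s => snd (u s)) (fun s => snd (v s))).
Qed.

Lemma cder_mult (u v : R -> C) (t : R) (du dv : C) :
  cder u t du -> cder v t dv -> cder (fun s => u s * v s)%C t (du * v t + u t * dv)%C.
Proof.
  intros [A B] [D E]; split; simpl.
  - replace (fst du * fst (v t) - snd du * snd (v t) + (fst (u t) * fst dv - snd (u t) * snd dv))
      with ((fst du * fst (v t) + fst (u t) * fst dv) - (snd du * snd (v t) + snd (u t) * snd dv)) by ring.
    apply (is_derive_minus (V := R_NormedModule)
      (fun s => fst (u s) * fst (v s)) (fun s => snd (u s) * snd (v s)));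
      apply (is_derive_mult (K := R_AbsRing)); auto; intros; apply Rmult_comm.
  - replace (fst du * snd (v t) + snd du * fst (v t) + (fst (u t) * snd dv + snd (u t) * fst dv))
      with ((fst du * snd (v t) + fst (u t) * snd dv) + (snd du * fst (v t) + snd (u t) * fst dv)) by ring.
    apply (is_derive_plus (V := R_NormedModule)
      (fun s => fst (u s) * snd (v s)) (fun s => snd (u s) * fst (v s)));
      apply (is_derive_mult (K := R_AbsRing)); auto; intros; apply Rmult_comm.
Qed.

Lemma cint_eq (u : R -> C) (a b : R) (l m : C) : cint u a b l -> l = m -> cint u a b m.
Proof. now intros H <-. Qed.

Lemma cint_ext (u v : R -> C) (a b : R) (l : C) :
  (forall t, Rmin a b <= t <= Rmax a b -> u t = v t) -> cint u a b l -> cint v a b l.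
Proof.
  intros H [A B]; split; [eapply is_RInt_ext, A | eapply is_RInt_ext, B];
    intros x Hx; simpl; rewrite H; auto; lra.
Qed.

Lemma CI_unique (u : R -> C) (a b : R) (l : C) : cint u a b l -> CI u a b = l.
Proof.
  intros [A B]. unfold CI. rewrite (is_RInt_unique _ _ _ _ A), (is_RInt_unique _ _ _ _ B).
  now destruct l.
Qed.

Lemma CI_correct (u : R -> C) (a b : R) :
  (forall t, Rmin a b <= t <= Rmax a b -> ccont u t) -> cint u a b (CI u a b).
Proof.
  intros H; split; simpl; apply (RInt_correct (V := R_CompleteNormedModule));
    apply (ex_RInt_continuous (V := R_CompleteNormedModule)); intros z Hz; now apply H.
Qed.

Lemma cint_plus (u v : R -> C) (a b : R) (l m : C) :
  cint u a b l -> cint v a b m -> cint (fun t => u t + v t)%C a b (l + m)%C.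
Proof.
  intros [A B] [D E]; split; simpl;
    [exact (is_RInt_plus (V := R_NormedModule) _ _ _ _ _ _ A D)
    |exact (is_RInt_plus (V := R_NormedModule) _ _ _ _ _ _ B E)].
Qed.

Lemma cint_opp (u : R -> C) (a b : R) (l : C) :
  cint u a b l -> cint (fun t => - u t)%C a b (- l)%C.
Proof.
  intros [A B]; split; simpl;
    [exact (is_RInt_opp (V := R_NormedModule) _ _ _ _ A)
    |exact (is_RInt_opp (V := R_NormedModule) _ _ _ _ B)].
Qed.

Lemma cint_minus (u v : R -> C) (a b : R) (l m : C) :
  cint u a b l -> cint v a b m -> cint (fun t => u t - v t)%C a b (l - m)%C.
Proof. intros H K. apply cint_plus; auto. now apply cint_opp. Qed.

Lemma cint_mult_const (c : C) (u : R -> C) (a b : R) (l : C) :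
  cint u a b l -> cint (fun t => c * u t)%C a b (c * l)%C.
Proof.
  intros [A B]; split; simpl.
  - exact (is_RInt_minus (V := R_NormedModule) _ _ _ _ _ _
      (is_RInt_scal _ _ _ (fst c) _ A) (is_RInt_scal _ _ _ (snd c) _ B)).
  - exact (is_RInt_plus (V := R_NormedModule) _ _ _ _ _ _
      (is_RInt_scal _ _ _ (fst c) _ B) (is_RInt_scal _ _ _ (snd c) _ A)).
Qed.

Lemma cint_const (c : C) (a b : R) : cint (fun _ => c) a b (RtoC (b - a) * c)%C.
Proof.
  split.
  - replace (fst (RtoC (b - a) * c)%C) with (scal (b - a) (fst c))
      by (unfold scal; simpl; unfold mult; simpl; ring).
    apply (is_RInt_const (V := R_NormedModule)).
  - replace (snd (RtoC (b - a) * c)%C) with (scal (b - a) (snd c))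
      by (unfold scal; simpl; unfold mult; simpl; ring).
    apply (is_RInt_const (V := R_NormedModule)).
Qed.

Lemma cint_Chasles (u : R -> C) (a b c : R) (l m : C) :
  cint u a b l -> cint u b c m -> cint u a c (l + m)%C.
Proof.
  intros [A B] [D E]; split;
    [exact (is_RInt_Chasles (V := R_NormedModule) _ _ _ _ _ _ A D)
    |exact (is_RInt_Chasles (V := R_NormedModule) _ _ _ _ _ _ B E)].
Qed.

Lemma cint_derive (u du : R -> C) (a b : R) :
  (forall t, Rmin a b <= t <= Rmax a b -> cder u t (du t)) ->
  (forall t, Rmin a b <= t <= Rmax a b -> ccont du t) ->
  cint du a b (u b - u a)%C.
Proof.
  intros H K; split.
  - apply (is_RInt_derive (V := R_CompleteNormedModule) (fun t => fst (u t)) (fun t => fst (du t)));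
      intros t Ht; [apply (H t Ht) | apply (K t Ht)].
  - apply (is_RInt_derive (V := R_CompleteNormedModule) (fun t => snd (u t)) (fun t => snd (du t)));
      intros t Ht; [apply (H t Ht) | apply (K t Ht)].
Qed.

(** A bound by coordinates would lose a constant. The pair of integrals is therefore read as one
    integral in the normed module [C_R_NormedModule], whose norm is [Cmod]. *)
Lemma cint_le (u : R -> C) (g : R -> R) (a b : R) (l : C) (m : R) :
  a <= b -> (forall t, a <= t <= b -> Cmod (u t) <= g t) ->
  cint u a b l -> is_RInt g a b m -> Cmod l <= m.
Proof.
  intros Hab H [A B] Hg.
  assert (N : forall z : C, norm (V := C_R_NormedModule) z = Cmod z).
  { intros [x y]. unfold norm; simpl. unfold prod_norm, norm; simpl. unfold abs; simpl.
    unfold Cmod; simpl. rewrite !Rmult_1_r. f_equal.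
    fold (Rsqr (Rabs x)) (Rsqr (Rabs y)). now rewrite <- !Rsqr_abs. }
  rewrite <- N.
  apply (norm_RInt_le (V := C_R_NormedModule) u g a b l m); auto.
  { intros t Ht. rewrite N. auto. }
  destruct l as [l1 l2].
  exact (is_RInt_fct_extend_pair (U := R_NormedModule) (V := R_NormedModule) u a b l1 l2 A B).
Qed.

Lemma cint_le_const (u : R -> C) (a b : R) (l : C) (M : R) :
  a <= b -> (forall t, a <= t <= b -> Cmod (u t) <= M) ->
  cint u a b l -> Cmod l <= (b - a) * M.
Proof.
  intros Hab H K. apply (cint_le u (fun _ => M) a b l); auto.
  apply (is_RInt_const (V := R_NormedModule)).
Qed.

(** * Complex derivatives *)

(** Through this bridge the sum, product and chain rules are inherited from [is_derive] over the
    field of complex numbers. *)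
Lemma Cderiv_is_derive (f : C -> C) (z d : C) :
  Cderiv f z d <->
  is_derive (K := C_AbsRing) (V := AbsRing_NormedModule C_AbsRing) f z d.
Proof.
  assert (E1 : forall a b : C, (a + (b - a))%C = b) by (intros; ring).
  assert (E2 : forall a b : C, (a + b - a)%C = b) by (intros; ring).
  rewrite CderivE. split.
  - intros H. split; [apply is_linear_scal_l|].
    intros x Hx. apply (is_filter_lim_locally_unique (K := C_AbsRing)
      (V := AbsRing_NormedModule C_AbsRing)) in Hx. subst x.
    intros [eps He]. destruct (H eps He) as [de [Hd K]].
    exists (mkposreal de Hd). intros w Hw.
    assert (Kw := K (w - z)%C Hw).
    unfold norm, minus, plus, opp, scal, mult; simpl. unfold abs; simpl.
    change (Cmod (f w - f z - (w - z) * d)%C <= eps * Cmod (w - z)%C).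
    rewrite E1 in Kw.
    now rewrite (Cmult_comm (w - z)).
  - intros [_ H] eps He.
    destruct (H z (fun P HP => HP) (mkposreal eps He)) as [[de Hd] K].
    exists de; split; auto. intros h Hh.
    assert (Kw := K (z + h)%C). simpl in Kw.
    unfold norm, minus, plus, opp, scal, mult in Kw; simpl in Kw. unfold abs in Kw; simpl in Kw.
    change (ball (M := AbsRing_UniformSpace C_AbsRing) z de (z + h)%C ->
      Cmod (f (z + h) - f z - (z + h - z) * d)%C <= eps * Cmod (z + h - z)%C) in Kw.
    rewrite E2 in Kw.
    rewrite (Cmult_comm d). apply Kw.
    change (Cmod (z + h - z)%C < de). now rewrite E2.
Qed.

Lemma Cderiv_eq (f : C -> C) (z d e : C) : Cderiv f z d -> d = e -> Cderiv f z e.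
Proof. now intros H <-. Qed.

Lemma Cderiv_const (c z : C) : Cderiv (fun _ => c) z (RtoC 0).
Proof. apply Cderiv_is_derive, (is_derive_const (K := C_AbsRing) (V := AbsRing_NormedModule C_AbsRing) c z). Qed.

Lemma Cderiv_id (z : C) : Cderiv (fun w => w) z (RtoC 1).
Proof. apply Cderiv_is_derive, (is_derive_id (K := C_AbsRing) z). Qed.

Lemma Cderiv_plus (f g : C -> C) (z d e : C) :
  Cderiv f z d -> Cderiv g z e -> Cderiv (fun w => f w + g w)%C z (d + e)%C.
Proof.
  rewrite !Cderiv_is_derive. intros H K.
  exact (is_derive_plus (K := C_AbsRing) (V := AbsRing_NormedModule C_AbsRing) f g z d e H K).
Qed.

Lemma Cderiv_minus (f g : C -> C) (z d e : C) :
  Cderiv f z d -> Cderiv g z e -> Cderiv (fun w => f w - g w)%C z (d - e)%C.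
Proof.
  rewrite !Cderiv_is_derive. intros H K.
  exact (is_derive_minus (K := C_AbsRing) (V := AbsRing_NormedModule C_AbsRing) f g z d e H K).
Qed.

Lemma Cderiv_mult (f g : C -> C) (z d e : C) :
  Cderiv f z d -> Cderiv g z e -> Cderiv (fun w => f w * g w)%C z (d * g z + f z * e)%C.
Proof.
  rewrite !Cderiv_is_derive. intros H K.
  exact (is_derive_mult (K := C_AbsRing) f g z d e H K Cmult_comm).
Qed.

Lemma Cderiv_comp (f g : C -> C) (z d e : C) :
  Cderiv f (g z) d -> Cderiv g z e -> Cderiv (fun w => f (g w)) z (e * d)%C.
Proof.
  rewrite !Cderiv_is_derive. intros H K.
  exact (is_derive_comp (K := C_AbsRing) (V := AbsRing_NormedModule C_AbsRing) f g z d e H K).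
Qed.

(** An explicit second-order remainder is what algebra yields for 1/z and for the Cauchy kernels,
    and such a remainder survives integration in a parameter. *)
Lemma Cderiv_quadratic (f : C -> C) (z d : C) (A delta : R) :
  0 < delta ->
  (forall h : C, Cmod h < delta -> Cmod (f (z + h) - f z - d * h)%C <= A * (Cmod h * Cmod h)) ->
  Cderiv f z d.
Proof.
  intros Hd H. apply CderivE. intros eps He.
  assert (HA := Rabs_pos A).
  assert (Hq : 0 < eps / (1 + Rabs A)) by (apply Rdiv_lt_0_compat; lra).
  exists (Rmin delta (eps / (1 + Rabs A))). split; [now apply Rmin_pos|].
  intros h Hh. apply Rle_trans with (1 := H h (Rlt_le_trans _ _ _ Hh (Rmin_l _ _))).
  assert (H2 := Rlt_le_trans _ _ _ Hh (Rmin_r _ _)).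
  apply Rmult_lt_compat_r with (r := 1 + Rabs A) in H2; [|lra].
  replace (eps / (1 + Rabs A) * (1 + Rabs A)) with eps in H2 by (field; lra).
  generalize (Cmod_ge_0 h) (Rle_abs A). nra.
Qed.

Lemma Cmod_pos_neq_0 (z : C) : 0 < Cmod z -> z <> RtoC 0.
Proof. intros H. now apply Cmod_gt_0. Qed.

Lemma Cderiv_inv (z : C) : z <> RtoC 0 -> Cderiv Cinv z (- (/ z * / z))%C.
Proof.
  intros Hz. assert (Hp := proj1 (Cmod_gt_0 z) Hz).
  apply (Cderiv_quadratic _ _ _ (2 / (Cmod z * Cmod z * Cmod z)) (Cmod z / 2)); [lra|].
  intros h Hh.
  assert (Hzh : Cmod z / 2 <= Cmod (z + h)%C).
  { generalize (Cmod_triangle (z + h)%C (- h)%C). rewrite Cmod_opp.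
    replace (z + h + - h)%C with z by ring. lra. }
  assert (N : (z + h)%C <> RtoC 0) by (apply Cmod_pos_neq_0; lra).
  replace (/ (z + h) - / z - - (/ z * / z) * h)%C with (/ (z * z * (z + h)) * (h * h))%C
    by (field; auto).
  rewrite !Cmod_mult, Cmod_inv, !Cmod_mult
    by (apply Cmod_pos_neq_0; rewrite !Cmod_mult; repeat apply Rmult_lt_0_compat; lra).
  apply Rmult_le_compat_r. { generalize (Cmod_ge_0 h); nra. }
  replace (2 / (Cmod z * Cmod z * Cmod z)) with (/ (Cmod z * Cmod z * (Cmod z / 2))) by (field; lra).
  apply Rinv_le_contravar; [repeat apply Rmult_lt_0_compat; lra|].
  apply Rmult_le_compat_l; [nra|lra].
Qed.

Lemma Cderiv_div (f g : C -> C) (z d e : C) :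
  g z <> RtoC 0 -> Cderiv f z d -> Cderiv g z e ->
  exists r, Cderiv (fun w => f w / g w)%C z r.
Proof.
  intros Hg Hf He. eexists. apply Cderiv_mult; [exact Hf|].
  apply Cderiv_comp with (f := Cinv); [|exact He]. apply Cderiv_inv; auto.
Qed.

Lemma Cderiv_unique (f : C -> C) (z d e : C) : Cderiv f z d -> Cderiv f z e -> d = e.
Proof.
  intros H K. apply NNPP. intros N.
  assert (P : 0 < Cmod (e - d)%C).
  { apply Cmod_gt_0. intros E. apply N. replace d with (e - (e - d))%C by ring. rewrite E. ring. }
  destruct (proj1 (CderivE f z d) H (Cmod (e - d)%C / 4)) as [d1 [Hd1 K1]]; [lra|].
  destruct (proj1 (CderivE f z e) K (Cmod (e - d)%C / 4)) as [d2 [Hd2 K2]]; [lra|].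
  pose (r := Rmin d1 d2 / 2).
  assert (Hr : 0 < r) by (unfold r; generalize (Rmin_pos d1 d2 Hd1 Hd2); lra).
  assert (Mr : Cmod r = r) by (rewrite Cmod_R, Rabs_pos_eq; lra).
  specialize (K1 (RtoC r)). specialize (K2 (RtoC r)). rewrite Mr in K1, K2.
  generalize (Rmin_l d1 d2) (Rmin_r d1 d2). fold r. intros R1 R2.
  assert (K3 := K1 ltac:(unfold r in *; lra)). assert (K4 := K2 ltac:(unfold r in *; lra)).
  generalize (Cmod_triangle_minus (f (z + r) - f z - d * r)%C (f (z + r) - f z - e * r)%C).
  replace (f (z + r) - f z - d * r - (f (z + r) - f z - e * r))%C with ((e - d) * r)%C by ring.
  rewrite Cmod_mult, Mr. nra.
Qed.

Lemma Cderiv_ext_loc (f g : C -> C) (z d : C) (delta : R) :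
  0 < delta -> (forall w : C, Cmod (w - z)%C < delta -> f w = g w) ->
  Cderiv f z d -> Cderiv g z d.
Proof.
  rewrite !CderivE. intros Hd E H eps He. destruct (H eps He) as [d1 [Hd1 K]].
  exists (Rmin delta d1). split; [now apply Rmin_pos|]. intros h Hh.
  rewrite <- !E.
  - apply K. apply Rlt_le_trans with (1 := Hh), Rmin_r.
  - replace (z - z)%C with (RtoC 0) by ring. now rewrite Cmod_0.
  - replace (z + h - z)%C with h by ring. apply Rlt_le_trans with (1 := Hh), Rmin_l.
Qed.

(** * Goursat on the unit square *)

(** The common point is the supremum of the left endpoints, since every right endpoint bounds all of
    them. *)
Lemma nested_intervals (s l : nat -> R) :
  (forall n, s n <= s (S n)) -> (forall n, s (S n) + l (S n) <= s n + l n) ->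
  (forall n, 0 <= l n) ->
  exists x, forall n, s n <= x <= s n + l n.
Proof.
  intros Hs Hl Hp.
  assert (Ms : forall n k, s n <= s (n + k)%nat).
  { intros n k; induction k as [|k IH]; [rewrite Nat.add_0_r; lra|].
    rewrite Nat.add_succ_r. specialize (Hs (n + k)%nat); lra. }
  assert (Ml : forall n k, s (n + k)%nat + l (n + k)%nat <= s n + l n).
  { intros n k; induction k as [|k IH]; [rewrite Nat.add_0_r; lra|].
    rewrite Nat.add_succ_r. specialize (Hl (n + k)%nat); lra. }
  assert (U : forall n m, s m <= s n + l n).
  { intros n m. destruct (Nat.le_ge_cases n m) as [H|H].
    - replace m with (n + (m - n))%nat by lia.
      generalize (Ml n (m - n)%nat) (Hp (n + (m - n))%nat); lra.
    - generalize (Ms m (n - m)%nat) (Hp n). replace (m + (n - m))%nat with n by lia. lra. }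
  destruct (completeness (fun y => exists n, y = s n)) as [x [Hx1 Hx2]].
  - exists (s 0%nat + l 0%nat). intros y [n ->]. apply U.
  - exists (s 0%nat), 0%nat; auto.
  - exists x. intros n; split.
    + apply Hx1. now exists n.
    + apply Hx2. intros y [m ->]. apply U.
Qed.

(** Bisection as an induction principle: if [P] failed on the unit square, it would fail on some
    quarter, and so on; the failing squares shrink to a point, where the local hypothesis
    contradicts the failure. *)
Lemma square_bisection (P : R -> R -> R -> Prop) :
  (forall s t l, 0 <= s -> 0 <= t -> 0 < l -> s + l <= 1 -> t + l <= 1 ->
     P s t (l / 2) -> P (s + l / 2) t (l / 2) -> P s (t + l / 2) (l / 2) ->
     P (s + l / 2) (t + l / 2) (l / 2) -> P s t l) ->
  (forall x y, 0 <= x <= 1 -> 0 <= y <= 1 -> exists d, 0 < d /\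
     forall s t l, 0 <= s -> 0 <= t -> 0 < l < d -> s + l <= 1 -> t + l <= 1 ->
       s <= x <= s + l -> t <= y <= t + l -> P s t l) ->
  P 0 0 1.
Proof.
  intros Hsub Hloc.
  apply NNPP. intros HN.
  (* Selects the first quarter on which [P] fails. The upper right quarter is the default: when [P]
     holds on the other three, it must fail there. *)
  pose (step := fun q : R * R * R =>
    let '(s, t, l) := q in
    if excluded_middle_informative (P s t (l / 2)) then
      if excluded_middle_informative (P (s + l / 2) t (l / 2)) then
        if excluded_middle_informative (P s (t + l / 2) (l / 2)) then
          (s + l / 2, t + l / 2, l / 2)
        else (s, t + l / 2, l / 2)
      else (s + l / 2, t, l / 2)
    else (s, t, l / 2)).
  pose (q := fun n => Nat.iter n step (0, 0, 1)).
  pose (s := fun n => fst (fst (q n))). pose (t := fun n => snd (fst (q n))).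
  pose (l := fun n => snd (q n)).
  assert (St : forall n, 0 <= s n -> 0 <= t n -> 0 < l n -> s n + l n <= 1 -> t n + l n <= 1 ->
    ~ P (s n) (t n) (l n) ->
    l (S n) = l n / 2 /\ (s (S n) = s n \/ s (S n) = s n + l n / 2) /\
    (t (S n) = t n \/ t (S n) = t n + l n / 2) /\ ~ P (s (S n)) (t (S n)) (l (S n))).
  { intros n. unfold s, t, l. replace (q (S n)) with (step (q n)) by reflexivity.
    destruct (q n) as [[a b] c]. simpl. intros Ha Hb Hc Hac Hbc Hn.
    specialize (Hsub a b c Ha Hb Hc Hac Hbc).
    destruct (excluded_middle_informative (P a b (c / 2))); simpl; [|auto].
    destruct (excluded_middle_informative (P (a + c / 2) b (c / 2))); simpl; [|auto].
    destruct (excluded_middle_informative (P a (b + c / 2) (c / 2))); simpl; [|auto].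
    repeat split; auto. }
  assert (Inv : forall n, 0 <= s n /\ 0 <= t n /\ l n = (1 / 2) ^ n /\ 0 < l n /\
     s n + l n <= 1 /\ t n + l n <= 1 /\ ~ P (s n) (t n) (l n)).
  { induction n as [|n (A & B & D & E & F & G & H)].
    - unfold s, t, l; simpl. repeat split; auto; lra.
    - destruct (St n A B E F G H) as (K1 & K2 & K3 & K4).
      split; [lra|]. split; [lra|].
      split; [rewrite K1, D; simpl; field|].
      repeat split; try lra; auto. }
  assert (St' : forall n, l (S n) = l n / 2 /\ (s (S n) = s n \/ s (S n) = s n + l n / 2) /\
    (t (S n) = t n \/ t (S n) = t n + l n / 2)).
  { intros n. destruct (Inv n) as (A & B & D & E & F & G & H).
    destruct (St n A B E F G H) as (K1 & K2 & K3 & K4); auto. }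
  assert (Lp : forall n, 0 < l n) by (intros n; apply (Inv n)).
  destruct (nested_intervals s l) as [x Hx];
    try (intros n; generalize (Lp n); destruct (St' n) as (K1 & K2 & K3); lra).
  destruct (nested_intervals t l) as [y Hy];
    try (intros n; generalize (Lp n); destruct (St' n) as (K1 & K2 & K3); lra).
  assert (H0 := Inv 0%nat). assert (X0 := Hx 0%nat). assert (Y0 := Hy 0%nat).
  destruct (Hloc x y) as [d [Hd K]]; [lra | lra |].
  destruct (pow_lt_1_zero (1 / 2)) with (y := d) as [N HN']; auto.
  { rewrite Rabs_pos_eq; lra. }
  specialize (HN' N (le_n N)).
  destruct (Inv N) as (A & B & D & E & F & G & H).
  apply H, K; auto. rewrite <- D, Rabs_pos_eq in HN'; lra.
Qed.

(* The integral of [f] along the image under [phi] of the boundary of the square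
   [[s, s+l] x [t, t+l]]; [phis] and [phit] are the partial derivatives of [phi]. *)
Definition square_int (f : C -> C) (phi phis phit : R -> R -> C) (s t l : R) : C :=
  (CI (fun x => f (phi x t) * phis x t)%C s (s + l)
   + CI (fun y => f (phi (s + l)%R y) * phit (s + l)%R y)%C t (t + l)
   - CI (fun x => f (phi x (t + l)%R) * phis x (t + l)%R)%C s (s + l)
   - CI (fun y => f (phi s y) * phit s y)%C t (t + l))%C.

(** The endpoint [a + l / 2 + l / 2] is left unsimplified so as to match the edges of a quarter
    square in [square_int]. *)
Lemma CI_halves (u : R -> C) (a l : R) :
  0 < l -> (forall x, a <= x <= a + l -> ccont u x) ->
  CI u a (a + l) = (CI u a (a + l / 2) + CI u (a + l / 2) (a + l / 2 + l / 2))%C.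
Proof.
  intros Hl H. apply CI_unique.
  apply cint_Chasles with (a + l / 2).
  - apply CI_correct. intros t. rewrite Rmin_left, Rmax_right by lra. intros; apply H; lra.
  - replace (a + l / 2 + l / 2) with (a + l) by field.
    apply CI_correct. intros t. rewrite Rmin_left, Rmax_right by lra. intros; apply H; lra.
Qed.

Lemma CI_add (u v : R -> C) (a b : R) :
  a <= b -> (forall x, a <= x <= b -> ccont u x) -> (forall x, a <= x <= b -> ccont v x) ->
  CI (fun x => u x + v x)%C a b = (CI u a b + CI v a b)%C.
Proof.
  intros Hab H K. apply CI_unique. apply cint_plus; apply CI_correct;
    intros t; rewrite Rmin_left, Rmax_right by lra; auto.
Qed.

Lemma CI_le (u : R -> C) (a b M : R) :
  a <= b -> (forall x, a <= x <= b -> ccont u x) -> (forall x, a <= x <= b -> Cmod (u x) <= M) ->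
  Cmod (CI u a b) <= (b - a) * M.
Proof.
  intros Hab H K. apply cint_le_const with u; auto. apply CI_correct.
  intros t; rewrite Rmin_left, Rmax_right by lra; auto.
Qed.

(** Each partial derivative is continuous along its own variable, as the fundamental theorem on the
    edges requires. Derivatives exist on the whole plane, so no one-sided derivatives arise at the
    boundary of the square. Injectivity is not asked for, so edges may collapse or coincide. *)
Record smooth_square (phi phis phit : R -> R -> C) (L : R) : Prop := {
  sq_ders : forall s t, cder (fun x => phi x t) s (phis s t);
  sq_dert : forall s t, cder (fun y => phi s y) t (phit s t);
  sq_cons : forall s t, ccont (fun x => phis x t) s;
  sq_cont : forall s t, ccont (fun y => phit s y) t;
  sq_bnds : forall s t, 0 <= s <= 1 -> 0 <= t <= 1 -> Cmod (phis s t) <= L;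
  sq_bndt : forall s t, 0 <= s <= 1 -> 0 <= t <= 1 -> Cmod (phit s t) <= L }.

Lemma cder_bounded (u du : R -> C) (a b L : R) :
  (forall t, Rmin a b <= t <= Rmax a b -> cder u t (du t)) ->
  (forall t, Rmin a b <= t <= Rmax a b -> ccont du t) ->
  (forall t, Rmin a b <= t <= Rmax a b -> Cmod (du t) <= L) ->
  Cmod (u b - u a)%C <= L * Rabs (b - a).
Proof.
  assert (G : forall a b, a <= b ->
    (forall t, a <= t <= b -> cder u t (du t)) -> (forall t, a <= t <= b -> ccont du t) ->
    (forall t, a <= t <= b -> Cmod (du t) <= L) -> Cmod (u b - u a)%C <= L * Rabs (b - a)).
  { intros x y Hxy A B D. rewrite Rabs_pos_eq, Rmult_comm by lra.
    apply cint_le_const with du; auto.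
    apply cint_derive; rewrite Rmin_left, Rmax_right by lra; auto. }
  intros A B D. destruct (Rle_dec a b) as [H|H].
  - rewrite Rmin_left, Rmax_right in * by lra. auto.
  - rewrite Rmin_right, Rmax_left in * by lra.
    rewrite Cmod_minus_sym, Rabs_minus_sym. apply G; auto; lra.
Qed.

Lemma smooth_square_lipschitz phi phis phit L x y s t :
  smooth_square phi phis phit L ->
  0 <= x <= 1 -> 0 <= y <= 1 -> 0 <= s <= 1 -> 0 <= t <= 1 ->
  Cmod (phi s t - phi x y)%C <= L * (Rabs (s - x) + Rabs (t - y)).
Proof.
  intros [D1 D2 C1 C2 B1 B2] Hx Hy Hs Ht.
  replace (phi s t - phi x y)%C with ((phi s t - phi x t) + (phi x t - phi x y))%C by ring.
  apply Rle_trans with (1 := Cmod_triangle _ _).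
  rewrite Rmult_plus_distr_l. apply Rplus_le_compat.
  - apply (cder_bounded (fun s => phi s t) (fun s => phis s t)); auto.
    intros r Hr; apply B1; auto.
    generalize (Rmin_glb x s 0) (Rmax_lub x s 1); lra.
  - apply (cder_bounded (fun t => phi x t) (fun t => phit x t)); auto.
    intros r Hr; apply B2; auto.
    generalize (Rmin_glb y t 0) (Rmax_lub y t 1); lra.
Qed.

Lemma cder_affine_primitive (c d : C) (u : R -> C) (t : R) (v : C) :
  cder u t v -> cder (fun s => c * u s + d * (/ 2 * (u s * u s)))%C t ((c + d * u t) * v)%C.
Proof.
  intros H.
  eapply cder_eq.
  - apply cder_plus; apply cder_mult; [apply cder_const| exact H | apply cder_const|].
    apply cder_mult; [apply cder_const|]. apply cder_mult; exact H.
  - simpl. field.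
Qed.

(** The integrand has the primitive c w + d w^2 / 2, so each edge contributes a difference of values
    at two corners, and around the boundary these cancel. *)
Lemma square_int_affine (phi phis phit : R -> R -> C) (L : R)
  (Hphi : smooth_square phi phis phit L) (c d : C) (s t l : R) :
  square_int (fun w => c + d * w)%C phi phis phit s t l = RtoC 0.
Proof.
  destruct Hphi as [D1 D2 C1 C2 B1 B2].
  assert (H1 : forall t a b, cint (fun x => (c + d * phi x t) * phis x t)%C a b
     ((c * phi b t + d * (/ 2 * (phi b t * phi b t)))
      - (c * phi a t + d * (/ 2 * (phi a t * phi a t))))%C).
  { intros t0 a b. apply (cint_derive (fun x => c * phi x t0 + d * (/ 2 * (phi x t0 * phi x t0)))%C).
    - intros x _. apply cder_affine_primitive with (u := fun x => phi x t0); auto.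
    - intros x _. apply ccont_mult; auto. apply ccont_plus; [apply ccont_const|].
      apply ccont_mult; [apply ccont_const|]. eapply cder_ccont, D1. }
  assert (H2 : forall s a b, cint (fun y => (c + d * phi s y) * phit s y)%C a b
     ((c * phi s b + d * (/ 2 * (phi s b * phi s b)))
      - (c * phi s a + d * (/ 2 * (phi s a * phi s a))))%C).
  { intros s0 a b. apply (cint_derive (fun y => c * phi s0 y + d * (/ 2 * (phi s0 y * phi s0 y)))%C).
    - intros x _. apply cder_affine_primitive with (u := fun y => phi s0 y); auto.
    - intros x _. apply ccont_mult; auto. apply ccont_plus; [apply ccont_const|].
      apply ccont_mult; [apply ccont_const|]. eapply cder_ccont, D2. }
  unfold square_int.
  rewrite !(CI_unique _ _ _ _ (H1 _ _ _)), !(CI_unique _ _ _ _ (H2 _ _ _)). ring.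
Qed.

Lemma square_int_le (phi phis phit : R -> R -> C) (L : R)
  (Hphi : smooth_square phi phis phit L) (g : C -> C) (s t l M : R) :
  0 <= s -> 0 <= t -> 0 <= l -> s + l <= 1 -> t + l <= 1 ->
  (forall x y, s <= x <= s + l -> t <= y <= t + l ->
     (exists d, Cderiv g (phi x y) d) /\ Cmod (g (phi x y)) <= M) ->
  Cmod (square_int g phi phis phit s t l) <= 4 * (l * (M * L)).
Proof.
  destruct Hphi as [D1 D2 C1 C2 B1 B2]. intros Hs Ht Hl Hsl Htl Hg.
  assert (H1 : forall y, t <= y <= t + l ->
    Cmod (CI (fun x => g (phi x y) * phis x y)%C s (s + l)) <= l * (M * L)).
  { intros y Hy. replace (l * (M * L)) with ((s + l - s) * (M * L)) by ring.
    apply CI_le; [lra| |]; intros x Hx; destruct (Hg x y Hx Hy) as [[d Hd] HM].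
    - apply ccont_mult; auto. apply ccont_comp with (u := fun x => phi x y) (d := d); auto.
      eapply cder_ccont, D1.
    - rewrite Cmod_mult. apply Rmult_le_compat; try apply Cmod_ge_0; auto. apply B1; lra. }
  assert (H2 : forall x, s <= x <= s + l ->
    Cmod (CI (fun y => g (phi x y) * phit x y)%C t (t + l)) <= l * (M * L)).
  { intros x Hx. replace (l * (M * L)) with ((t + l - t) * (M * L)) by ring.
    apply CI_le; [lra| |]; intros y Hy; destruct (Hg x y Hx Hy) as [[d Hd] HM].
    - apply ccont_mult; auto. apply ccont_comp with (u := fun y => phi x y) (d := d); auto.
      eapply cder_ccont, D2.
    - rewrite Cmod_mult. apply Rmult_le_compat; try apply Cmod_ge_0; auto. apply B2; lra. }
  unfold square_int.
  eapply Rle_trans; [apply Cmod_triangle_minus|].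
  eapply Rle_trans; [apply Rplus_le_compat_r, Cmod_triangle_minus|].
  eapply Rle_trans; [apply Rplus_le_compat_r, Rplus_le_compat_r, Cmod_triangle|].
  generalize (H1 t) (H1 (t + l)) (H2 s) (H2 (s + l)). lra.
Qed.

Lemma square_int_plus (phi phis phit : R -> R -> C) (L : R)
  (Hphi : smooth_square phi phis phit L) (g h : C -> C) (s t l : R) :
  0 <= l ->
  (forall x y, s <= x <= s + l -> t <= y <= t + l ->
     (exists d, Cderiv g (phi x y) d) /\ (exists d, Cderiv h (phi x y) d)) ->
  square_int (fun w => g w + h w)%C phi phis phit s t l =
  (square_int g phi phis phit s t l + square_int h phi phis phit s t l)%C.
Proof.
  destruct Hphi as [D1 D2 C1 C2 B1 B2]. intros Hl Hg.
  assert (H1 : forall y, t <= y <= t + l ->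
    CI (fun x => (g (phi x y) + h (phi x y)) * phis x y)%C s (s + l) =
    (CI (fun x => g (phi x y) * phis x y)%C s (s + l)
     + CI (fun x => h (phi x y) * phis x y)%C s (s + l))%C).
  { intros y Hy. rewrite <- CI_add; [|lra| |].
    - unfold CI. f_equal; apply (RInt_ext (V := R_CompleteNormedModule)); intros; simpl; ring.
    - intros x Hx; destruct (Hg x y Hx Hy) as [[d Hd] _].
      apply ccont_mult; auto. apply ccont_comp with (u := fun x => phi x y) (d := d); auto.
      eapply cder_ccont, D1.
    - intros x Hx; destruct (Hg x y Hx Hy) as [_ [d Hd]].
      apply ccont_mult; auto. apply ccont_comp with (u := fun x => phi x y) (d := d); auto.
      eapply cder_ccont, D1. }
  assert (H2 : forall x, s <= x <= s + l ->
    CI (fun y => (g (phi x y) + h (phi x y)) * phit x y)%C t (t + l) =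
    (CI (fun y => g (phi x y) * phit x y)%C t (t + l)
     + CI (fun y => h (phi x y) * phit x y)%C t (t + l))%C).
  { intros x Hx. rewrite <- CI_add; [|lra| |].
    - unfold CI. f_equal; apply (RInt_ext (V := R_CompleteNormedModule)); intros; simpl; ring.
    - intros y Hy; destruct (Hg x y Hx Hy) as [[d Hd] _].
      apply ccont_mult; auto. apply ccont_comp with (u := fun y => phi x y) (d := d); auto.
      eapply cder_ccont, D2.
    - intros y Hy; destruct (Hg x y Hx Hy) as [_ [d Hd]].
      apply ccont_mult; auto. apply ccont_comp with (u := fun y => phi x y) (d := d); auto.
      eapply cder_ccont, D2. }
  unfold square_int. rewrite !H1, !H2 by lra. ring.
Qed.

(** Each inner edge is traversed twice, in opposite directions. *)
Lemma square_int_subdivide (f : C -> C) phi phis phit L s t l :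
  smooth_square phi phis phit L -> 0 < l ->
  (forall x y, s <= x <= s + l -> t <= y <= t + l -> exists d, Cderiv f (phi x y) d) ->
  square_int f phi phis phit s t l =
  (square_int f phi phis phit s t (l / 2) + square_int f phi phis phit (s + l / 2)%R t (l / 2)
   + square_int f phi phis phit s (t + l / 2)%R (l / 2)
   + square_int f phi phis phit (s + l / 2)%R (t + l / 2)%R (l / 2))%C.
Proof.
  intros [D1 D2 C1 C2 B1 B2] Hl Hf.
  assert (H1 : forall y, t <= y <= t + l ->
    CI (fun x => f (phi x y) * phis x y)%C s (s + l) =
    (CI (fun x => f (phi x y) * phis x y)%C s (s + l / 2)
     + CI (fun x => f (phi x y) * phis x y)%C (s + l / 2) (s + l / 2 + l / 2))%C).
  { intros y Hy. apply CI_halves; auto. intros x Hx. destruct (Hf x y Hx Hy) as [d Hd].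
    apply ccont_mult; auto. apply ccont_comp with (u := fun x => phi x y) (d := d); auto.
    eapply cder_ccont, D1. }
  assert (H2 : forall x, s <= x <= s + l ->
    CI (fun y => f (phi x y) * phit x y)%C t (t + l) =
    (CI (fun y => f (phi x y) * phit x y)%C t (t + l / 2)
     + CI (fun y => f (phi x y) * phit x y)%C (t + l / 2) (t + l / 2 + l / 2))%C).
  { intros x Hx. apply CI_halves; auto. intros y Hy. destruct (Hf x y Hx Hy) as [d Hd].
    apply ccont_mult; auto. apply ccont_comp with (u := fun y => phi x y) (d := d); auto.
    eapply cder_ccont, D2. }
  unfold square_int. rewrite !H1, !H2 by lra.
  replace (s + l / 2 + l / 2) with (s + l) by field.
  replace (t + l / 2 + l / 2) with (t + l) by field.
  ring.
Qed.

Lemma goursat_square (f : C -> C) phi phis phit L :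
  smooth_square phi phis phit L ->
  (forall x y, 0 <= x <= 1 -> 0 <= y <= 1 -> exists d, Cderiv f (phi x y) d) ->
  square_int f phi phis phit 0 0 1 = RtoC 0.
Proof.
  intros Hphi Hf.
  assert (HL : 0 <= L).
  { apply Rle_trans with (1 := Cmod_ge_0 (phis 0 0)). apply (sq_bnds _ _ _ _ Hphi); lra. }
  apply Cmod_eq_0, Rle_antisym; [|apply Cmod_ge_0].
  apply le_epsilon. intros eps He. rewrite Rplus_0_l.
  (* The area on the right is additive: four quarters contribute 4 eps (l/2)^2 = eps l^2, so the
     bound passes from the quarters to the whole. *)
  pose (P := fun s t l => Cmod (square_int f phi phis phit s t l) <= eps * (l * l)).
  replace eps with (eps * (1 * 1)) by ring. change (P 0 0 1).
  apply square_bisection; unfold P; clear P.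
  - intros s t l Hs Ht Hl Hsl Htl A B D E.
    rewrite (square_int_subdivide f phi phis phit L) by
      (auto; intros; apply Hf; lra).
    eapply Rle_trans; [apply Cmod_triangle|].
    eapply Rle_trans; [apply Rplus_le_compat_r, Cmod_triangle|].
    eapply Rle_trans; [apply Rplus_le_compat_r, Rplus_le_compat_r, Cmod_triangle|].
    lra.
  - intros x y Hx Hy. destruct (Hf x y Hx Hy) as [d Hd].
    (* The remainder will be at most eta * 2 l L on four edges of length at most l L, in total 8 eta
       L^2 l^2. Writing L + 1 for L keeps the denominator positive. *)
    pose (eta := eps / (8 * (L + 1) * (L + 1))).
    assert (Heta : 0 < eta) by (apply Rdiv_lt_0_compat; nra).
    destruct (proj1 (CderivE f _ d) Hd eta Heta) as [de [Hde K]].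
    (* A square of side l containing (x, y) is mapped within 2 l L of [phi x y], which must stay
       below [de]. *)
    exists (de / (2 * (L + 1))). split; [apply Rdiv_lt_0_compat; lra|].
    intros s t l Hs Ht Hl Hsl Htl Hxs Hyt.
    (* c + d w is the first-order expansion of f at [phi x y]. Its boundary integral vanishes, so
       only the remainder [g] is estimated. *)
    pose (c := (f (phi x y) - d * phi x y)%C).
    pose (g := (fun w => f w - (c + d * w))%C).
    assert (Hlin : forall z, exists e, Cderiv (fun w => c + d * w)%C z e).
    { intros z. eexists. apply Cderiv_plus; [apply Cderiv_const|].
      apply Cderiv_mult; [apply Cderiv_const | apply Cderiv_id]. }
    assert (Hg : forall a b, s <= a <= s + l -> t <= b <= t + l ->
      exists e, Cderiv g (phi a b) e).
    { intros a b Ha Hb. destruct (Hf a b) as [e1 K1]; [lra|lra|].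
      destruct (Hlin (phi a b)) as [e2 K2]. exists (e1 - e2)%C.
      now apply Cderiv_minus with (g := fun w => (c + d * w)%C). }
    replace f with (fun w => g w + (c + d * w))%C.
    2: { apply functional_extensionality. intros w. unfold g. ring. }
    rewrite (square_int_plus phi phis phit L Hphi g (fun w => c + d * w)%C);
      [|lra|intros; split; auto].
    rewrite (square_int_affine phi phis phit L Hphi), Cplus_0_r.
    apply Rle_trans with (4 * (l * ((eta * (L * (l + l))) * L))).
    + apply square_int_le; auto; [lra|]. intros a b Ha Hb. split; auto.
      assert (Hlip : Cmod (phi a b - phi x y)%C <= L * (l + l)).
      { eapply Rle_trans; [apply (smooth_square_lipschitz _ _ _ L x y a b Hphi); lra|].
        apply Rmult_le_compat_l; auto. apply Rplus_le_compat; apply Rabs_le; lra. }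
      assert (Hl2 : l * (2 * (L + 1)) < de).
      { destruct Hl as [Hl0 Hl]. apply Rmult_lt_compat_r with (r := 2 * (L + 1)) in Hl; [|lra].
        replace (de / (2 * (L + 1)) * (2 * (L + 1))) with de in Hl by (field; lra). lra. }
      assert (Kw := K (phi a b - phi x y)%C ltac:(nra)).
      replace (phi x y + (phi a b - phi x y))%C with (phi a b) in Kw by ring.
      unfold g, c.
      replace (f (phi a b) - (f (phi x y) - d * phi x y + d * phi a b))%C
        with (f (phi a b) - f (phi x y) - d * (phi a b - phi x y))%C by ring.
      apply Rle_trans with (1 := Kw). apply Rmult_le_compat_l; lra.
    + replace eps with (eta * (8 * (L + 1) * (L + 1))) by (unfold eta; field; lra).
      replace (4 * (l * (eta * (L * (l + l)) * L))) with ((eta * (l * l)) * (8 * (L * L))) by ring.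
      replace (eta * (8 * (L + 1) * (L + 1)) * (l * l))
        with ((eta * (l * l)) * (8 * ((L + 1) * (L + 1)))) by ring.
      apply Rmult_le_compat_l; [|nra].
      apply Rmult_le_pos; [lra|]. nra.
Qed.

(** * Primitives and the deformation of circles *)

Lemma inD_Cmod (z : C) : inD z <-> Cmod z < 1.
Proof. unfold inD. now rewrite Cnorm_Cmod. Qed.

Lemma CI_ext (u v : R -> C) (a b : R) :
  (forall t, Rmin a b < t < Rmax a b -> u t = v t) -> CI u a b = CI v a b.
Proof.
  intros H. unfold CI. f_equal; apply (RInt_ext (V := R_CompleteNormedModule));
    intros t Ht; now rewrite H.
Qed.

Lemma CI_correct01 (u : R -> C) : (forall t, 0 <= t <= 1 -> ccont u t) -> cint u 0 1 (CI u 0 1).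
Proof. intros H. apply CI_correct. rewrite Rmin_left, Rmax_right by lra. auto. Qed.

Lemma convex_comb_pos (a b s : R) : 0 < a -> 0 < b -> 0 <= s <= 1 -> 0 < (1 - s) * a + s * b.
Proof. intros Ha Hb Hs. destruct (Rle_dec s (1 / 2)); nra. Qed.

Lemma Cmod_segment (z k : C) (t rho : R) :
  Cmod z < rho -> Cmod (z + k)%C < rho -> 0 <= t <= 1 -> Cmod (z + t * k)%C < rho.
Proof.
  intros Hz Hk Ht.
  replace (z + t * k)%C with (RtoC (1 - t) * z + RtoC t * (z + k))%C
    by (rewrite RtoC_minus; ring).
  apply Rle_lt_trans with (1 := Cmod_triangle _ _).
  rewrite !Cmod_Rmult by lra.
  generalize (convex_comb_pos (rho - Cmod z) (rho - Cmod (z + k)%C) t). lra.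
Qed.

Lemma ccont_RtoC (t : R) : ccont RtoC t.
Proof. eapply cder_ccont, cder_id. Qed.

Lemma HD_ccont_ray (h : C -> C) (z : C) (t : R) :
  HD h -> Cmod z < 1 -> 0 <= t <= 1 -> ccont (fun t => h (t * z) * z)%C t.
Proof.
  intros Hh Hz Ht. destruct (Hh (t * z)%C) as [d Hd].
  { apply inD_Cmod. rewrite Cmod_Rmult; [|lra]. generalize (Cmod_ge_0 z). nra. }
  apply ccont_mult; [|apply ccont_const].
  apply ccont_comp with (u := fun t : R => (t * z)%C) (d := d); auto.
  apply ccont_mult; [apply ccont_RtoC | apply ccont_const].
Qed.

(** The map (s, t) to s (z + t k) collapses the edge s = 0 to the origin, so Goursat on the square
    becomes Cauchy's theorem for the triangle with vertices 0, z, z + k. *)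
Lemma ray_primitive_increment (h : C -> C) (z k : C) :
  HD h -> Cmod z < 1 -> Cmod (z + k)%C < 1 ->
  cint (fun t => h (z + t * k) * k)%C 0 1
    (CI (fun t => h (t * (z + k)) * (z + k))%C 0 1 - CI (fun t => h (t * z) * z)%C 0 1)%C.
Proof.
  intros Hh Hz Hk.
  pose (phi := fun s t : R => (s * (z + t * k))%C).
  pose (phis := fun s t : R => (z + t * k)%C).
  pose (phit := fun s t : R => (s * k)%C).
  (* The constant 2 works because z + t k lies in the disk and k is a difference of two points of
     it. *)
  assert (Hs : smooth_square phi phis phit 2).
  { split; unfold phi, phis, phit; intros s t.
    - eapply cder_eq; [apply cder_mult; [apply cder_id | apply cder_const]|]. simpl. ring.
    - eapply cder_eq; [apply cder_mult; [apply cder_const |]|].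
      + apply cder_plus; [apply cder_const | apply cder_mult; [apply cder_id | apply cder_const]].
      + simpl. ring.
    - apply ccont_const.
    - apply ccont_const.
    - intros Hs Ht. generalize (Cmod_segment z k t 1 Hz Hk Ht). lra.
    - intros Hs Ht. rewrite Cmod_Rmult by lra.
      generalize (Cmod_triangle_minus (z + k)%C z) (Cmod_ge_0 k).
      replace (z + k - z)%C with k by ring. nra. }
  assert (Hd : forall s t, 0 <= s <= 1 -> 0 <= t <= 1 -> exists d, Cderiv h (phi s t) d).
  { intros s t H1 H2. apply Hh, inD_Cmod. unfold phi. rewrite Cmod_Rmult by lra.
    generalize (Cmod_segment z k t 1 Hz Hk H2) (Cmod_ge_0 (z + t * k)%C). nra. }
  assert (G := goursat_square h phi phis phit 2 Hs Hd).
  unfold square_int in G. rewrite !Rplus_0_l in G. unfold phi, phis, phit in G.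
  assert (E1 : CI (fun x => h (x * (z + RtoC 0 * k)) * (z + RtoC 0 * k))%C 0 1
    = CI (fun t => h (t * z) * z)%C 0 1).
  { apply CI_ext. intros t _. now replace (z + RtoC 0 * k)%C with z by ring. }
  assert (E2 : CI (fun x => h (x * (z + RtoC 1 * k)) * (z + RtoC 1 * k))%C 0 1
    = CI (fun t => h (t * (z + k)) * (z + k))%C 0 1).
  { apply CI_ext. intros t _. now replace (z + RtoC 1 * k)%C with (z + k)%C by ring. }
  assert (E3 : CI (fun y => h (RtoC 0 * (z + y * k)) * (RtoC 0 * k))%C 0 1 = RtoC 0).
  { apply CI_unique. eapply cint_ext; [|eapply cint_eq; [apply (cint_const (RtoC 0))|]].
    - intros; simpl; ring.
    - ring. }
  assert (E4 : CI (fun y => h (RtoC 1 * (z + y * k)) * (RtoC 1 * k))%C 0 1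
     = CI (fun t => h (z + t * k) * k)%C 0 1).
  { apply CI_ext. intros t _. now rewrite !Cmult_1_l. }
  rewrite E1, E2, E3, E4 in G.
  eapply cint_eq.
  - apply CI_correct01. intros t Ht. apply ccont_mult; [|apply ccont_const].
    destruct (Hh (z + t * k)%C) as [d Hd']; [apply inD_Cmod, Cmod_segment; auto|].
    apply ccont_comp with (u := fun t : R => (z + t * k)%C) (d := d); auto.
    apply ccont_plus; [apply ccont_const|].
    apply ccont_mult; [apply ccont_RtoC | apply ccont_const].
  - match type of G with (?a + ?b - ?c - _)%C = _ =>
      replace b with ((a + b - c - RtoC 0) + (c - a))%C by ring end.
    rewrite G. ring.
Qed.

(** The increment minus h(z) k is the integral of (h(z + t k) - h(z)) k over [0, 1], which is small
    compared with k by continuity of h at z. *)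
Lemma ray_primitive (h : C -> C) (z : C) :
  HD h -> Cmod z < 1 -> Cderiv (fun w => CI (fun t => h (t * w) * w)%C 0 1) z (h z).
Proof.
  intros Hh Hz. apply CderivE. intros eps He.
  destruct (Hh z) as [d Hd]; [now apply inD_Cmod|].
  destruct (Cderiv_cont _ _ _ Hd eps He) as [d1 [Hd1 K]].
  exists (Rmin d1 (1 - Cmod z)). split; [apply Rmin_pos; lra|].
  intros k Hk.
  assert (Hk1 := Rlt_le_trans _ _ _ Hk (Rmin_l _ _)).
  assert (Hk2 := Rlt_le_trans _ _ _ Hk (Rmin_r _ _)).
  assert (Hzk : Cmod (z + k)%C < 1) by (generalize (Cmod_triangle z k); lra).
  assert (I := cint_minus _ _ _ _ _ _ (ray_primitive_increment h z k Hh Hz Hzk)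
    (cint_const (h z * k)%C 0 1)).
  rewrite Rminus_0_r, Cmult_1_l in I.
  replace (eps * Cmod k) with ((1 - 0) * (eps * Cmod k)) by ring.
  eapply cint_le_const; [lra| |exact I].
  intros t Ht. simpl.
  replace (h (z + t * k) * k - h z * k)%C with ((h (z + t * k) - h z) * k)%C by ring.
  rewrite Cmod_mult. apply Rmult_le_compat_r; [apply Cmod_ge_0|].
  apply Rlt_le, K. replace (z + t * k - z)%C with (t * k)%C by ring.
  rewrite Cmod_Rmult by lra. generalize (Cmod_ge_0 k). nra.
Qed.

(** Measuring angles in full turns fits the unit square and turns dw / (2 pi i w) into dt, so the
    Cauchy formulas below carry no factor 2 pi i. *)
Definition circ (t : R) : C := (cos (2 * PI * t), sin (2 * PI * t)).

Lemma Cmod_circ (t : R) : Cmod (circ t) = 1.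
Proof.
  unfold Cmod, circ; simpl.
  replace (cos (2 * PI * t) * (cos (2 * PI * t) * 1) + sin (2 * PI * t) * (sin (2 * PI * t) * 1))
    with (Rsqr (sin (2 * PI * t)) + Rsqr (cos (2 * PI * t))) by (unfold Rsqr; ring).
  rewrite sin2_cos2. apply sqrt_1.
Qed.

Lemma circ_neq_0 (t : R) : circ t <> RtoC 0.
Proof. apply Cmod_pos_neq_0. rewrite Cmod_circ; lra. Qed.

Lemma circ_1 : circ 1 = circ 0.
Proof.
  unfold circ. rewrite Rmult_1_r, Rmult_0_r, cos_2PI, sin_2PI, cos_0, sin_0. reflexivity.
Qed.

Lemma cder_circ (t : R) : cder circ t ((0, 2 * PI)%R * circ t)%C.
Proof.
  split; unfold circ; simpl; auto_derive; auto; ring.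
Qed.

Lemma ccont_circ (t : R) : ccont circ t.
Proof. eapply cder_ccont, cder_circ. Qed.

(* The circle [|w| = r] is deformed to the circle [|w - z| = eps] without crossing [z]. *)
Lemma cauchy_deformation (f : C -> C) (z : C) (r eps : R) :
  HD f -> Cmod z < r -> r < 1 -> 0 < eps < r - Cmod z ->
  CI (fun t => f (r * circ t) * (r * circ t) / (r * circ t - z))%C 0 1 =
  CI (fun t => f (z + eps * circ t))%C 0 1.
Proof.
  intros Hf Hz Hr He.
  (* [tau] is 2 pi i. The homotopy [phi] moves the centre linearly from 0 to z and the radius
     linearly from r to eps. *)
  pose (tau := (0, 2 * PI) : C).
  pose (phi := fun s t : R => (s * z + RtoC (r + s * (eps - r)) * circ t)%C).
  pose (phis := fun s t : R => (z + RtoC (eps - r) * circ t)%C).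
  pose (phit := fun s t : R => (RtoC (r + s * (eps - r)) * (tau * circ t))%C).
  pose (G := fun w : C => (f w / (w - z))%C).
  assert (Hmt : Cmod tau = 2 * PI).
  { unfold tau, Cmod; simpl. generalize PI_RGT_0; intros HP.
    replace (0 * (0 * 1) + 2 * PI * (2 * PI * 1)) with (Rsqr (2 * PI)) by (unfold Rsqr; ring).
    apply sqrt_Rsqr. lra. }
  assert (HPI := PI2_1). assert (Hz0 := Cmod_ge_0 z).
  assert (Hs : smooth_square phi phis phit (1 + 2 * PI)).
  { split; unfold phi, phis, phit; intros s t.
    - eapply cder_eq.
      + apply cder_plus; apply cder_mult; [apply cder_id | apply cder_const | | apply cder_const].
        instantiate (1 := RtoC (eps - r)). split; simpl; auto_derive; auto; ring.
      + simpl. ring.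
    - eapply cder_eq.
      + apply cder_plus; [apply cder_const | apply cder_mult; [apply cder_const | apply cder_circ]].
      + simpl. unfold tau. ring.
    - apply ccont_const.
    - apply ccont_mult; [apply ccont_const|].
      apply ccont_mult; [apply ccont_const|apply ccont_circ].
    - intros Hs Ht. eapply Rle_trans; [apply Cmod_triangle|].
      rewrite Cmod_mult, Cmod_R, Cmod_circ, Rabs_minus_sym, Rabs_pos_eq; lra.
    - intros Hs Ht. specialize (convex_comb_pos r eps s); intros Hc.
      rewrite Cmod_Rmult by lra. rewrite Cmod_mult, Cmod_circ, Hmt.
      specialize (convex_comb_pos (1 - r) (1 - eps) s). intros Hc'.
      assert (r + s * (eps - r) <= 1) by lra. nra. }
  assert (Hrho : forall s, 0 <= s <= 1 -> 0 < r + s * (eps - r)).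
  { intros s H. generalize (convex_comb_pos r eps s). lra. }
  (* The distance to the unit circle is at least (1 - s)(1 - r) + s (1 - |z| - eps). *)
  assert (HphiD : forall s t, 0 <= s <= 1 -> Cmod (phi s t) < 1).
  { intros s t H. unfold phi. eapply Rle_lt_trans; [apply Cmod_triangle|].
    specialize (Hrho s H). rewrite !Cmod_Rmult, Cmod_circ by lra.
    generalize (convex_comb_pos (1 - r) (1 - Cmod z - eps) s). lra. }
  (* The distance to z is at least (1 - s)(r - |z|) + s eps, so no intermediate circle meets the
     pole. *)
  assert (HphiZ : forall s t, 0 <= s <= 1 -> (phi s t - z)%C <> RtoC 0).
  { intros s t H. apply Cmod_pos_neq_0. unfold phi. specialize (Hrho s H).
    replace (s * z + RtoC (r + s * (eps - r)) * circ t - z)%C with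
      (RtoC (r + s * (eps - r)) * circ t - RtoC (1 - s) * z)%C by (rewrite RtoC_minus; ring).
    eapply Rlt_le_trans; [|apply Cmod_triangle_rev].
    rewrite !Cmod_Rmult, Cmod_circ by lra.
    generalize (convex_comb_pos (r - Cmod z) eps s). lra. }
  assert (Hd : forall s t, 0 <= s <= 1 -> 0 <= t <= 1 -> exists d, Cderiv G (phi s t) d).
  { intros s t H1 H2. destruct (Hf (phi s t)) as [d Hd]; [apply inD_Cmod; auto|].
    unfold G. eapply Cderiv_div with (g := fun w => (w - z)%C); eauto.
    apply Cderiv_minus; [apply Cderiv_id | apply Cderiv_const]. }
  assert (GS := goursat_square G phi phis phit _ Hs Hd).
  unfold square_int in GS. rewrite !Rplus_0_l in GS.
  (* The circles are closed, so the edges t = 0 and t = 1 have the same image and cancel in the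
     boundary integral; the two circles remain. *)
  assert (Etop : CI (fun x => G (phi x 1) * phis x 1)%C 0 1 = CI (fun x => G (phi x 0) * phis x 0)%C 0 1).
  { apply CI_ext. intros t _. unfold phi, phis. now rewrite circ_1. }
  assert (P0 : forall t, phi 0 t = (r * circ t)%C).
  { intros t. unfold phi. rewrite Rmult_0_l, Rplus_0_r. ring. }
  assert (P1 : forall t, phi 1 t = (z + eps * circ t)%C).
  { intros t. unfold phi. replace (r + 1 * (eps - r)) with eps by ring. ring. }
  assert (El : CI (fun y => G (phi 0 y) * phit 0 y)%C 0 1 =
    (tau * CI (fun t => f (r * circ t) * (r * circ t) / (r * circ t - z))%C 0 1)%C).
  { apply CI_unique. eapply cint_ext; [|apply cint_mult_const, CI_correct01].
    - intros t Ht. simpl. unfold G, phit. rewrite P0, Rmult_0_l, Rplus_0_r. unfold Cdiv. ring.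
    - intros t Ht. apply ccont_mult.
      + apply ccont_mult; [|apply ccont_mult; [apply ccont_const | apply ccont_circ]].
        destruct (Hf (r * circ t)%C) as [d Hd']; [rewrite <- P0; apply inD_Cmod, HphiD; lra|].
        apply ccont_comp with (u := fun t => (r * circ t)%C) (d := d); auto.
        apply ccont_mult; [apply ccont_const | apply ccont_circ].
      + apply ccont_comp with (f := Cinv) (u := fun t => (r * circ t - z)%C)
          (d := (- (/ (r * circ t - z) * / (r * circ t - z)))%C).
        * apply Cderiv_inv. rewrite <- P0. apply HphiZ; lra.
        * apply ccont_minus; [apply ccont_mult; [apply ccont_const | apply ccont_circ]|apply ccont_const]. }
  assert (Er : CI (fun y => G (phi 1 y) * phit 1 y)%C 0 1 =
    (tau * CI (fun t => f (z + eps * circ t))%C 0 1)%C).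
  { apply CI_unique. eapply cint_ext; [|apply cint_mult_const, CI_correct01].
    - intros t Ht. simpl. unfold G, phit. rewrite P1.
      replace (r + 1 * (eps - r)) with eps by ring.
      replace (z + eps * circ t - z)%C with (eps * circ t)%C by ring.
      assert (N := circ_neq_0 t).
      assert (N2 : RtoC eps <> RtoC 0) by (apply Cmod_pos_neq_0; rewrite Cmod_R, Rabs_pos_eq; lra).
      field; auto.
    - intros t Ht. destruct (Hf (z + eps * circ t)%C) as [d Hd'].
      { rewrite <- P1; apply inD_Cmod, HphiD; lra. }
      apply ccont_comp with (u := fun t => (z + eps * circ t)%C) (d := d); auto.
      apply ccont_plus; [apply ccont_const|].
      apply ccont_mult; [apply ccont_const | apply ccont_circ]. }
  rewrite Etop, El, Er in GS.
  assert (Ht0 : tau <> RtoC 0) by (apply Cmod_pos_neq_0; lra).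
  match type of GS with (?a + tau * ?b - _ - tau * ?c)%C = _ =>
    replace c with (b - / tau * (a + tau * b - a - tau * c))%C by (field; auto) end.
  rewrite GS. ring.
Qed.

(** * Cauchy formula and estimates *)

Lemma ccont_bounded (u : R -> C) (a b : R) :
  a <= b -> (forall t, a <= t <= b -> ccont u t) ->
  exists M, forall t, a <= t <= b -> Cmod (u t) <= M.
Proof.
  intros Hab H.
  destruct (continuity_ab_maj (fun t => Cmod (u t)) a b Hab) as [m [Hm _]].
  - intros t Ht. apply continuity_pt_filterlim.
    change (continuous (fun t => Cmod (u t)) t). apply continuous_eps. intros eps He.
    destruct (proj1 (ccont_eps _ _) (H t Ht) eps He) as [d [Hd K]].
    exists d; split; auto. intros s Hs. specialize (K s Hs).
    generalize (Cmod_triangle_rev (u s) (u t)) (Cmod_triangle_rev (u t) (u s)).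
    rewrite (Cmod_minus_sym (u t)). intros. apply Rabs_def1; lra.
  - exists (Cmod (u m)). auto.
Qed.

Lemma Cmod_circle_gap (z : C) (r t : R) :
  0 <= r -> r - Cmod z <= Cmod (r * circ t - z)%C.
Proof.
  intros Hr. generalize (Cmod_triangle_rev (r * circ t)%C z).
  rewrite Cmod_Rmult, Cmod_circ by lra. lra.
Qed.

Lemma circle_gap_neq_0 (z : C) (r t : R) : Cmod z < r -> (r * circ t - z)%C <> RtoC 0.
Proof.
  intros H. apply Cmod_pos_neq_0. generalize (Cmod_circle_gap z r t) (Cmod_ge_0 z). lra.
Qed.

Lemma ccont_cauchy_kernel (z : C) (r t : R) :
  Cmod z < r -> ccont (fun t => / (r * circ t - z))%C t.
Proof.
  intros H. apply ccont_comp with (f := Cinv) (u := fun t => (r * circ t - z)%C)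
    (d := (- (/ (r * circ t - z) * / (r * circ t - z)))%C).
  - apply Cderiv_inv. now apply circle_gap_neq_0.
  - apply ccont_minus; [apply ccont_mult; [apply ccont_const | apply ccont_circ]|apply ccont_const].
Qed.

Lemma ccont_on_circle (f : C -> C) (z : C) (r t : R) :
  HD f -> 0 <= r -> Cmod z + r < 1 -> ccont (fun t => f (z + r * circ t))%C t.
Proof.
  intros Hf Hr H. destruct (Hf (z + r * circ t)%C) as [d Hd].
  { apply inD_Cmod. eapply Rle_lt_trans; [apply Cmod_triangle|].
    rewrite Cmod_Rmult, Cmod_circ; lra. }
  apply ccont_comp with (u := fun t => (z + r * circ t)%C) (d := d); auto.
  apply ccont_plus; [apply ccont_const|].
  apply ccont_mult; [apply ccont_const | apply ccont_circ].
Qed.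

Lemma ccont_on_circle0 (f : C -> C) (r t : R) :
  HD f -> 0 <= r < 1 -> ccont (fun t => f (r * circ t))%C t.
Proof.
  intros Hf Hr.
  replace (fun t => f (r * circ t)%C) with (fun t => f (RtoC 0 + r * circ t)%C).
  - apply ccont_on_circle; auto; [lra|]. rewrite Cmod_0. lra.
  - apply functional_extensionality. intros s. now rewrite Cplus_0_l.
Qed.

(** By deformation the integral is the mean of f over every small circle about z, and these means
    tend to f(z) by continuity. *)
Lemma cauchy_formula (f : C -> C) (z : C) (r : R) :
  HD f -> Cmod z < r -> r < 1 ->
  cint (fun t => f (r * circ t) * (r * circ t) / (r * circ t - z))%C 0 1 (f z).
Proof.
  intros Hf Hz Hr. assert (Hz0 := Cmod_ge_0 z).
  eapply cint_eq.
  - apply CI_correct01. intros t _. apply ccont_mult; [|now apply ccont_cauchy_kernel].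
    apply ccont_mult; [apply ccont_on_circle0; auto; lra|].
    apply ccont_mult; [apply ccont_const | apply ccont_circ].
  - set (I := CI _ 0 1).
    assert (E : (I - f z)%C = RtoC 0).
    { apply Cmod_eq_0, Rle_antisym; [|apply Cmod_ge_0].
      apply le_epsilon. intros eta Heta. rewrite Rplus_0_l.
      destruct (Hf z) as [d Hd]; [apply inD_Cmod; lra|].
      destruct (Cderiv_cont _ _ _ Hd eta Heta) as [d1 [Hd1 K]].
      (* Small enough both for the continuity of f at z and for the deformation from |w| = r;
         halving makes both inequalities strict. *)
      pose (eps := Rmin d1 (r - Cmod z) / 2).
      assert (0 < Rmin d1 (r - Cmod z)) by (apply Rmin_pos; lra).
      generalize (Rmin_l d1 (r - Cmod z)) (Rmin_r d1 (r - Cmod z)). intros Hl1 Hl2.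
      assert (He : 0 < eps) by (unfold eps; lra).
      assert (He2 : eps < d1) by (unfold eps; lra).
      assert (He3 : eps < r - Cmod z) by (unfold eps; lra).
      unfold I. rewrite (cauchy_deformation f z r eps) by (auto; lra).
      assert (J := cint_minus _ _ _ _ _ _
        (CI_correct01 (fun t => f (z + eps * circ t)%C)
          (fun t _ => ccont_on_circle f z eps t Hf ltac:(lra) ltac:(lra)))
        (cint_const (f z) 0 1)).
      rewrite Rminus_0_r, Cmult_1_l in J.
      replace eta with ((1 - 0) * eta) by ring.
      eapply cint_le_const; [lra| |exact J].
      intros t Ht. apply Rlt_le, K.
      replace (z + eps * circ t - z)%C with (eps * circ t)%C by ring.
      rewrite Cmod_Rmult, Cmod_circ; lra. }
    replace I with (I - f z + f z)%C by ring. rewrite E. ring.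
Qed.

(** * Differentiation of Cauchy integrals in the parameter *)

(** A second-order remainder uniform in t integrates to a second-order remainder for [F]. *)
Lemma Cderiv_under_integral (k dk : C -> R -> C) (F : C -> C) (z dF : C) (A delta : R) :
  0 < delta ->
  (forall h : C, Cmod h < delta -> cint (k (z + h)%C) 0 1 (F (z + h)%C)) ->
  cint (dk z) 0 1 dF ->
  (forall (h : C) t, Cmod h < delta -> 0 <= t <= 1 ->
     Cmod (k (z + h) t - k z t - dk z t * h)%C <= A * (Cmod h * Cmod h)) ->
  Cderiv F z dF.
Proof.
  intros Hd HF HdF H. apply (Cderiv_quadratic _ _ _ A delta Hd). intros h Hh.
  assert (H0 := HF (RtoC 0)). rewrite Cmod_0, Cplus_0_r in H0. specialize (H0 Hd).
  assert (I := cint_minus _ _ _ _ _ _ (cint_minus _ _ _ _ _ _ (HF h Hh) H0)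
    (cint_mult_const h _ _ _ _ HdF)).
  rewrite (Cmult_comm h) in I.
  replace (A * (Cmod h * Cmod h)) with ((1 - 0) * (A * (Cmod h * Cmod h))) by ring.
  eapply cint_le_const; [lra| |exact I].
  intros t Ht. simpl. rewrite (Cmult_comm h). now apply H.
Qed.

Lemma Cmod_inv_le (q : C) (d : R) : 0 < d -> d <= Cmod q -> Cmod (/ q)%C <= / d.
Proof.
  intros Hd H. rewrite Cmod_inv by (apply Cmod_pos_neq_0; lra).
  now apply Rinv_le_contravar.
Qed.

Lemma Cmod_mult_le (x y : C) (a b : R) :
  Cmod x <= a -> Cmod y <= b -> Cmod (x * y)%C <= a * b.
Proof. intros. rewrite Cmod_mult. apply Rmult_le_compat; auto; apply Cmod_ge_0. Qed.

Lemma cauchy_integral_derive1 (u : R -> C) (r : R) (z : C) :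
  (forall t, 0 <= t <= 1 -> ccont u t) -> Cmod z < r ->
  Cderiv (fun z => CI (fun t => u t / (r * circ t - z))%C 0 1) z
    (CI (fun t => u t * (/ (r * circ t - z) * / (r * circ t - z)))%C 0 1).
Proof.
  intros Hu Hz.
  destruct (ccont_bounded u 0 1) as [M HM]; [lra|auto|].
  (* For |h| < d both denominators, at z and at z + h, have modulus at least d. With p and q their
     inverses, q - p - p^2 h = p^2 q h^2, which gives the constant M / d^3. *)
  pose (d := (r - Cmod z) / 2).
  assert (Hd : 0 < d) by (unfold d; lra).
  assert (Hdz : forall h, Cmod h < d -> Cmod (z + h)%C < r).
  { intros h Hh. generalize (Cmod_triangle z h). unfold d in *; lra. }
  apply (Cderiv_under_integral (fun z t => u t / (r * circ t - z))%C
    (fun z t => u t * (/ (r * circ t - z) * / (r * circ t - z)))%C _ _ _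
    (M * (/ d * / d * / d)) d Hd).
  - intros h Hh. apply CI_correct01. intros t Ht.
    apply ccont_mult; auto. now apply ccont_cauchy_kernel, Hdz.
  - apply CI_correct01. intros t Ht.
    apply ccont_mult; auto. apply ccont_mult; now apply ccont_cauchy_kernel.
  - intros h t Hh Ht.
    assert (G1 := Cmod_circle_gap z r t). assert (G2 := Cmod_circle_gap (z + h)%C r t).
    assert (N1 := circle_gap_neq_0 z r t Hz). assert (N2 := circle_gap_neq_0 (z + h)%C r t (Hdz h Hh)).
    assert (Hz0 := Cmod_ge_0 z). generalize (Cmod_triangle z h); intros T.
    unfold Cdiv.
    replace (u t * / (r * circ t - (z + h)) - u t * / (r * circ t - z)
       - u t * (/ (r * circ t - z) * / (r * circ t - z)) * h)%C
      with ((u t * (/ (r * circ t - z) * / (r * circ t - z) * / (r * circ t - (z + h)))) * (h * h))%C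
      by (field; auto).
    apply Cmod_mult_le; [|rewrite Cmod_mult; lra].
    apply Cmod_mult_le; auto.
    repeat apply Cmod_mult_le; apply Cmod_inv_le; auto; unfold d in *; lra.
Qed.

Lemma cauchy_integral_derive2 (u : R -> C) (r : R) (z : C) :
  (forall t, 0 <= t <= 1 -> ccont u t) -> Cmod z < r ->
  exists d, Cderiv (fun z => CI (fun t => u t * (/ (r * circ t - z) * / (r * circ t - z)))%C 0 1) z d.
Proof.
  intros Hu Hz.
  destruct (ccont_bounded u 0 1) as [M HM]; [lra|auto|].
  pose (d := (r - Cmod z) / 2).
  assert (Hd : 0 < d) by (unfold d; lra).
  assert (Hdz : forall h, Cmod h < d -> Cmod (z + h)%C < r).
  { intros h Hh. generalize (Cmod_triangle z h). unfold d in *; lra. }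
  pose (dk := fun (z : C) t => (u t * (RtoC 2 * (/ (r * circ t - z)
     * (/ (r * circ t - z) * / (r * circ t - z)))))%C).
  exists (CI (dk z) 0 1).
  apply (Cderiv_under_integral (fun z t => u t * (/ (r * circ t - z) * / (r * circ t - z)))%C
    dk _ _ _ (M * (/ d * / d * (/ d * / d) + 2 * (/ d * / d * (/ d * / d)))) d Hd).
  - intros h Hh. apply CI_correct01. intros t Ht.
    apply ccont_mult; auto. apply ccont_mult; now apply ccont_cauchy_kernel, Hdz.
  - apply CI_correct01. intros t Ht. unfold dk.
    repeat apply ccont_mult; auto; try (now apply ccont_cauchy_kernel). apply ccont_const.
  - intros h t Hh Ht. unfold dk.
    assert (G1 := Cmod_circle_gap z r t). assert (G2 := Cmod_circle_gap (z + h)%C r t).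
    assert (N1 := circle_gap_neq_0 z r t Hz). assert (N2 := circle_gap_neq_0 (z + h)%C r t (Hdz h Hh)).
    assert (Hz0 := Cmod_ge_0 z). generalize (Cmod_triangle z h); intros T.
    set (p := (/ (r * circ t - z))%C). set (q := (/ (r * circ t - (z + h)))%C).
    (* The identity follows from q - p = p q h, used twice. *)
    replace (u t * (q * q) - u t * (p * p) - u t * (RtoC 2 * (p * (p * p))) * h)%C
      with ((u t * (p * p * (q * q) + RtoC 2 * (p * p * (p * q)))) * (h * h))%C
      by (unfold p, q; field; auto).
    assert (Hp : Cmod p <= / d) by (apply Cmod_inv_le; auto; unfold d in *; lra).
    assert (Hq : Cmod q <= / d) by (apply Cmod_inv_le; auto; unfold d in *; lra).
    apply Cmod_mult_le; [|rewrite Cmod_mult; lra].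
    apply Cmod_mult_le; auto.
    eapply Rle_trans; [apply Cmod_triangle|].
    apply Rplus_le_compat; repeat apply Cmod_mult_le; auto.
    rewrite Cmod_R, Rabs_pos_eq; lra.
Qed.

Lemma derivative_cauchy_formula (f : C -> C) (z d : C) (r : R) :
  HD f -> Cmod z < r -> r < 1 -> Cderiv f z d ->
  d = CI (fun t => (f (r * circ t) * (r * circ t))
                   * (/ (r * circ t - z) * / (r * circ t - z)))%C 0 1.
Proof.
  intros Hf Hz Hr Hd. assert (Hz0 := Cmod_ge_0 z). apply (Cderiv_unique f z); auto.
  apply (Cderiv_ext_loc (fun z => CI (fun t => f (r * circ t) * (r * circ t) / (r * circ t - z))%C 0 1)
     f z _ (r - Cmod z)); [lra| |].
  - intros w Hw. apply CI_unique, cauchy_formula; auto.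
    generalize (Cmod_triangle (w - z)%C z). replace (w - z + z)%C with w by ring. lra.
  - apply (cauchy_integral_derive1 (fun t => f (r * circ t) * (r * circ t))%C); auto.
    intros t _. apply ccont_mult; [apply ccont_on_circle0; auto; lra|].
    apply ccont_mult; [apply ccont_const | apply ccont_circ].
Qed.

(** Near z, f' coincides with the integral of f against the squared kernel on a fixed circle, and
    that integral is differentiable in z whatever the continuous density. *)
Lemma HD_derivative (f fp : C -> C) :
  HD f -> (forall z, inD z -> Cderiv f z (fp z)) -> HD fp.
Proof.
  intros Hf Hfp z Hz. apply inD_Cmod in Hz. assert (Hz0 := Cmod_ge_0 z).
  pose (r := (1 + Cmod z) / 2).
  assert (Hr1 : Cmod z < r) by (unfold r; lra). assert (Hr2 : r < 1) by (unfold r; lra).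
  destruct (cauchy_integral_derive2 (fun t => f (r * circ t) * (r * circ t))%C r z) as [d Hd]; auto.
  { intros t _. apply ccont_mult; [apply ccont_on_circle0; auto; lra|].
    apply ccont_mult; [apply ccont_const | apply ccont_circ]. }
  exists d.
  eapply (Cderiv_ext_loc _ fp z d (r - Cmod z)); [lra| |exact Hd].
  intros w Hw. simpl. symmetry.
  assert (Hwr : Cmod w < r).
  { generalize (Cmod_triangle (w - z)%C z). replace (w - z + z)%C with w by ring. lra. }
  apply derivative_cauchy_formula; auto. apply Hfp, inD_Cmod. lra.
Qed.

(** Rescaling by w to a + rho w moves the problem to the unit disk, where the derivative formula on
    |w| = 1/2 gives M * (1/2) * 2 * 2 = 2 M. *)
Lemma cauchy_estimate (f : C -> C) (a d : C) (rho M : R) :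
  HD f -> 0 < rho -> Cmod a + rho <= 1 -> Cderiv f a d ->
  (forall w : C, Cmod (w - a)%C <= rho / 2 -> Cmod (f w) <= M) ->
  Cmod d <= 2 * M / rho.
Proof.
  intros Hf Hrho Ha Hd HM.
  pose (g := fun w : C => f (a + rho * w)%C).
  assert (Haff : forall w, Cderiv (fun w => a + rho * w)%C w (RtoC rho)).
  { intros w. eapply Cderiv_eq; [apply Cderiv_plus; [apply Cderiv_const|]|].
    - apply Cderiv_mult; [apply Cderiv_const | apply Cderiv_id].
    - simpl. ring. }
  assert (Hg : HD g).
  { intros w Hw. apply inD_Cmod in Hw. destruct (Hf (a + rho * w)%C) as [e He].
    - apply inD_Cmod. eapply Rle_lt_trans; [apply Cmod_triangle|].
      rewrite Cmod_Rmult by lra. nra.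
    - eexists. exact (Cderiv_comp f (fun w => (a + rho * w)%C) w _ _ He (Haff w)). }
  assert (Hgd : Cderiv g (RtoC 0) (rho * d)%C).
  { apply (Cderiv_comp f (fun w => (a + rho * w)%C)); auto.
    now replace (a + rho * RtoC 0)%C with a by ring. }
  assert (E := derivative_cauchy_formula g (RtoC 0) (rho * d)%C (1 / 2) Hg).
  rewrite Cmod_0 in E. specialize (E ltac:(lra) ltac:(lra) Hgd).
  assert (B : Cmod (rho * d)%C <= (1 - 0) * (M * (1 / 2) * (2 * 2))).
  { rewrite E. apply CI_le; [lra| |].
    - intros t _. apply ccont_mult.
      + apply ccont_mult; [apply ccont_on_circle0; auto; lra|].
        apply ccont_mult; [apply ccont_const | apply ccont_circ].
      + apply ccont_mult; apply ccont_cauchy_kernel; rewrite Cmod_0; lra.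
    - intros t _. apply Cmod_mult_le.
      + apply Cmod_mult_le.
        * apply HM. replace (a + rho * (RtoC (1 / 2) * circ t) - a)%C
            with (rho * (RtoC (1 / 2) * circ t))%C by ring.
          rewrite !Cmod_Rmult, Cmod_circ; lra.
        * rewrite Cmod_Rmult, Cmod_circ; lra.
      + replace (2 * 2) with (/ (1 / 2) * / (1 / 2)) by field.
        apply Cmod_mult_le; apply Cmod_inv_le; try lra;
          replace (RtoC (1 / 2) * circ t - RtoC 0)%C with (RtoC (1 / 2) * circ t)%C by ring;
          rewrite Cmod_Rmult, Cmod_circ; lra. }
  rewrite Cmod_Rmult in B by lra.
  apply Rmult_le_reg_l with rho; auto.
  replace (rho * (2 * M / rho)) with (2 * M) by (field; lra). lra.
Qed.

(** * Weighted growth and the operator *)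

Lemma Rpower_pos (x a : R) : 0 < Rpower x a.
Proof. apply exp_pos. Qed.

Lemma weight_Cmod (a : R) (z : C) : weight a z = Rpower (1 - Cmod z ^ 2) a.
Proof. unfold weight. now rewrite Cnorm_Cmod. Qed.

Lemma Hinf_bound_Cmod (a N : R) (f : C -> C) :
  Hinf_bound a f N <->
  forall z : C, Cmod z < 1 -> Rpower (1 - Cmod z ^ 2) a * Cmod (f z) <= N.
Proof.
  unfold Hinf_bound. split; intros H z Hz.
  - rewrite <- weight_Cmod, <- Cnorm_Cmod. apply H. now apply inD_Cmod.
  - rewrite weight_Cmod, Cnorm_Cmod. apply H. now apply inD_Cmod.
Qed.

Lemma disk_weight_pos (z : C) : Cmod z < 1 -> 0 < 1 - Cmod z ^ 2.
Proof. intros H. generalize (Cmod_ge_0 z). nra. Qed.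

Lemma Hinf_derivative_bound (f : C -> C) (alpha N : R) (a d : C) :
  HD f -> 0 <= alpha -> Hinf_bound alpha f N -> Cmod a < 1 -> Cderiv f a d ->
  Cmod d * Rpower (1 - Cmod a ^ 2) (alpha + 1) <= 4 * Rpower 4 alpha * N.
Proof.
  intros Hf Hal HN Ha Hd. rewrite Hinf_bound_Cmod in HN.
  assert (Ha0 := Cmod_ge_0 a). assert (Hx := disk_weight_pos a Ha).
  set (x := 1 - Cmod a ^ 2) in *.
  pose (rho := 1 - Cmod a).
  assert (Hrho : 0 < rho) by (unfold rho; lra).
  assert (Hxr : x <= 2 * rho) by (unfold x, rho; nra).
  (* On |w - a| <= rho / 2 one has 1 - |w|^2 >= 1 - |w| >= rho / 2 >= x / 4, so [W] is a lower bound
     for the weight there. This is the origin of the factor 4^alpha. *)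
  set (W := Rpower (x / 4) alpha). assert (HW : 0 < W) by apply Rpower_pos.
  assert (HN0 : 0 <= N).
  { eapply Rle_trans; [|apply (HN a Ha)]. apply Rmult_le_pos; [left; apply Rpower_pos | apply Cmod_ge_0]. }
  assert (B : forall w : C, Cmod (w - a)%C <= rho / 2 -> Cmod (f w) <= N / W).
  { intros w Hw.
    assert (Hw1 : Cmod w <= 1 - rho / 2).
    { generalize (Cmod_triangle (w - a)%C a). replace (w - a + a)%C with w by ring.
      unfold rho in *; lra. }
    assert (Hw0 := Cmod_ge_0 w).
    apply Rmult_le_reg_r with W; auto.
    replace (N / W * W) with N by (field; lra).
    eapply Rle_trans; [|apply (HN w); lra]. rewrite (Rmult_comm (Rpower _ _)).
    apply Rmult_le_compat_l; [apply Cmod_ge_0|].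
    apply Rle_Rpower_l; auto. split; [lra|]. nra. }
  assert (E := cauchy_estimate f a d rho (N / W) Hf Hrho ltac:(unfold rho; lra) Hd B).
  assert (EW : Rpower x (alpha + 1) = Rpower 4 alpha * W * x).
  { rewrite Rpower_plus, Rpower_1 by auto. unfold W.
    rewrite Rpower_mult_distr by lra. f_equal. f_equal. field. }
  rewrite EW. assert (H4 := Rpower_pos 4 alpha).
  apply Rle_trans with (2 * (N / W) / rho * (Rpower 4 alpha * W * x)).
  { apply Rmult_le_compat_r; auto. repeat apply Rmult_le_pos; lra. }
  replace (2 * (N / W) / rho * (Rpower 4 alpha * W * x))
    with (2 * Rpower 4 alpha * N * (x / rho)) by (field; lra).
  replace (4 * Rpower 4 alpha * N) with (2 * Rpower 4 alpha * N * 2) by ring.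
  apply Rmult_le_compat_l; [apply Rmult_le_pos; lra|].
  apply Rmult_le_reg_r with rho; auto. replace (x / rho * rho) with x by (field; lra). lra.
Qed.

Lemma Cscal_RtoC (t : R) (z : C) : Cscal t z = (t * z)%C.
Proof. unfold Cscal, Cmult. simpl. f_equal; ring. Qed.

Lemma seg_int_cint (h : C -> C) (z l : C) :
  seg_int h z l <-> cint (fun t => h (t * z) * z)%C 0 1 l.
Proof.
  unfold cint, seg_int.
  replace (fun s : R => fst (h (s * z) * z)%C) with (fun t => fst (Cmul (h (Cscal t z)) z))
    by (apply functional_extensionality; intros t; now rewrite Cscal_RtoC).
  replace (fun s : R => snd (h (s * z) * z)%C) with (fun t => snd (Cmul (h (Cscal t z)) z))
    by (apply functional_extensionality; intros t; now rewrite Cscal_RtoC).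
  split.
  - intros (p1 & p2 & <- & <-). rewrite <- !RInt_Reals.
    split; apply (RInt_correct (V := R_CompleteNormedModule)); now apply ex_RInt_Reals_1.
  - intros [A B].
    exists (ex_RInt_Reals_0 _ _ _ (ex_intro _ _ A)), (ex_RInt_Reals_0 _ _ _ (ex_intro _ _ B)).
    rewrite <- !RInt_Reals.
    split; [now apply (is_RInt_unique (V := R_CompleteNormedModule))
           |now apply (is_RInt_unique (V := R_CompleteNormedModule))].
Qed.

Lemma HD_mult (f g : C -> C) : HD f -> HD g -> HD (fun w => f w * g w)%C.
Proof.
  intros Hf Hg z Hz. destruct (Hf z Hz) as [d Hd]. destruct (Hg z Hz) as [e He].
  eexists. apply Cderiv_mult; eauto.
Qed.

(** [F] is prescribed only inside the disk, so it is compared with the ray integral on the disc of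
    radius 1 - |z| about z. *)
Lemma Sg_derive (g f F fp : C -> C) (z : C) :
  HD g -> HD fp ->
  (forall z, inD z -> seg_int (fun w => Cmul (fp w) (g w)) z (F z)) ->
  inD z -> Cderiv F z (fp z * g z)%C.
Proof.
  intros Hg Hfp HF Hz. apply inD_Cmod in Hz.
  apply (Cderiv_ext_loc (fun z => CI (fun t => fp (t * z) * g (t * z) * z)%C 0 1) F z _ (1 - Cmod z));
    [lra| |].
  - intros w Hw. apply CI_unique.
    apply (proj1 (seg_int_cint (fun w => fp w * g w)%C w (F w))), HF, inD_Cmod.
    generalize (Cmod_triangle (w - z)%C z). replace (w - z + z)%C with w by ring. lra.
  - apply (ray_primitive (fun w => fp w * g w)%C); auto. now apply HD_mult.
Qed.

(** * Growth of integrals along rays *)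

Lemma is_RInt_Rpower_ray (rho beta : R) :
  0 <= rho < 1 -> 0 < beta ->
  is_RInt (fun t => Rpower (1 - t * rho) (- (beta + 1)) * rho) 0 1
    ((Rpower (1 - rho) (- beta) - 1) / beta).
Proof.
  intros Hr Hb.
  replace ((Rpower (1 - rho) (- beta) - 1) / beta) with
    (minus (Rpower (1 - 1 * rho) (- beta) / beta) (Rpower (1 - 0 * rho) (- beta) / beta)).
  2: { unfold minus, plus, opp; simpl. rewrite Rmult_1_l, Rmult_0_l, Rminus_0_r.
       replace (Rpower 1 (- beta)) with 1. { field. lra. }
       unfold Rpower. now rewrite ln_1, Rmult_0_r, exp_0. }
  assert (Hp : forall t, Rmin 0 1 <= t <= Rmax 0 1 -> 0 < 1 - t * rho).
  { intros t. rewrite Rmin_left, Rmax_right by lra. intros Ht. nra. }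
  apply (is_RInt_derive (V := R_CompleteNormedModule) (fun t => Rpower (1 - t * rho) (- beta) / beta)).
  - intros t Ht. specialize (Hp t Ht). unfold Rpower. auto_derive; [lra|].
    replace (- (beta + 1) * ln (1 - t * rho)) with (- beta * ln (1 - t * rho) + - ln (1 - t * rho)) by ring.
    unfold Rminus in *. rewrite exp_plus, exp_Ropp, exp_ln by lra. field. lra.
  - intros t Ht. specialize (Hp t Ht). unfold Rpower.
    apply (ex_derive_continuous (V := R_NormedModule)). auto_derive. lra.
Qed.

(** Along the ray, 1 - (t rho)^2 >= 1 - t rho lets the weight be replaced by one with an explicit
    primitive. Returning from 1 - rho to 1 - rho^2 <= 2 (1 - rho) costs the factor 2^beta. *)
Lemma ray_integral_growth (h : C -> C) (z l : C) (beta A : R) :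
  0 < beta ->
  (forall w : C, Cmod w < 1 -> Cmod (h w) * Rpower (1 - Cmod w ^ 2) (beta + 1) <= A) ->
  Cmod z < 1 -> cint (fun t => h (t * z) * z)%C 0 1 l ->
  Rpower (1 - Cmod z ^ 2) beta * Cmod l <= Rpower 2 beta / beta * A.
Proof.
  intros Hb Hh Hz Hl. assert (Hz0 := Cmod_ge_0 z).
  set (rho := Cmod z) in *.
  assert (HA : 0 <= A).
  { eapply Rle_trans; [|apply (Hh z Hz)]. apply Rmult_le_pos; [apply Cmod_ge_0 | left; apply Rpower_pos]. }
  assert (B : Cmod l <= A * ((Rpower (1 - rho) (- beta) - 1) / beta)).
  { eapply cint_le; [| |exact Hl|].
    - lra.
    - instantiate (1 := fun t => A * (Rpower (1 - t * rho) (- (beta + 1)) * rho)).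
      intros t Ht. simpl. rewrite Cmod_mult. fold rho. rewrite <- Rmult_assoc.
      apply Rmult_le_compat_r; auto.
      assert (Et : Cmod (t * z)%C = t * rho) by (apply Cmod_Rmult; lra).
      assert (Htr : 0 <= t * rho < 1) by nra.
      specialize (Hh (t * z)%C). rewrite Et in Hh. specialize (Hh ltac:(lra)).
      rewrite Rpower_Ropp.
      assert (P := Rpower_pos (1 - t * rho) (beta + 1)).
      apply Rmult_le_reg_r with (Rpower (1 - t * rho) (beta + 1)); auto.
      replace (A * / Rpower (1 - t * rho) (beta + 1) * Rpower (1 - t * rho) (beta + 1)) with A
        by (field; lra).
      eapply Rle_trans; [|exact Hh]. apply Rmult_le_compat_l; [apply Cmod_ge_0|].
      apply Rle_Rpower_l; [lra|]. split; [lra|]. nra.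
    - apply (is_RInt_scal (V := R_NormedModule) _ _ _ A). apply is_RInt_Rpower_ray; auto. }
  set (P := Rpower (1 - rho) beta). assert (HP : 0 < P) by apply Rpower_pos.
  rewrite Rpower_Ropp in B. fold P in B.
  assert (Hw : Rpower (1 - rho ^ 2) beta <= Rpower 2 beta * P).
  { unfold P. rewrite Rpower_mult_distr by lra. apply Rle_Rpower_l; [lra|]. nra. }
  assert (H2 := Rpower_pos 2 beta).
  assert (B' : Cmod l <= A * (/ P / beta)).
  { eapply Rle_trans; [exact B|]. apply Rmult_le_compat_l; auto.
    unfold Rdiv. apply Rmult_le_compat_r; [left; now apply Rinv_0_lt_compat|lra]. }
  eapply Rle_trans; [apply Rmult_le_compat; [left; apply Rpower_pos|apply Cmod_ge_0|exact Hw|exact B']|].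
  right. field. lra.
Qed.

(** * The test functions *)

Lemma Cderiv_pow_ex (f : C -> C) (z d : C) (n : nat) :
  Cderiv f z d -> exists e, Cderiv (fun w => f w ^ n)%C z e.
Proof.
  intros H. induction n as [|n [e He]]; simpl.
  - eexists. apply Cderiv_const.
  - eexists. apply Cderiv_mult; eauto.
Qed.

(** The first three bounds come from |1 - conj(a) w| >= 1 - |a| |w|. The last one comes from |1 -
    conj(a) w|^2 - |w - a|^2 = (1 - |a|^2)(1 - |w|^2). *)
Lemma Cmod_one_minus_conj (a w : C) :
  Cmod a < 1 -> Cmod w < 1 ->
  0 < Cmod (1 - Cconj a * w)%C /\ 1 - Cmod a ^ 2 <= 2 * Cmod (1 - Cconj a * w)%C /\
  1 - Cmod w ^ 2 <= 2 * Cmod (1 - Cconj a * w)%C /\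
  Cmod (w - a)%C <= Cmod (1 - Cconj a * w)%C.
Proof.
  intros Ha Hw. generalize (Cmod_ge_0 a) (Cmod_ge_0 w); intros Ha0 Hw0.
  assert (T : 1 - Cmod a * Cmod w <= Cmod (1 - Cconj a * w)%C).
  { generalize (Cmod_triangle_rev 1 (Cconj a * w)%C).
    rewrite Cmod_1, Cmod_mult, Cmod_conj. auto. }
  repeat split; try nra.
  apply Rsqr_incr_0_var; [|apply Cmod_ge_0]. rewrite !Rsqr_pow2, !Cmod2_alt.
  destruct a as [a1 a2], w as [w1 w2]. unfold Cconj, Re, Im. simpl.
  assert (Ea := Cmod2_alt (a1, a2)). assert (Ew := Cmod2_alt (w1, w2)).
  unfold Re, Im in Ea, Ew; simpl in Ea, Ew.
  set (p := Cmod (a1, a2)) in *. set (q := Cmod (w1, w2)) in *.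
  assert (0 <= (1 - (a1 * (a1 * 1) + a2 * (a2 * 1))) * (1 - (w1 * (w1 * 1) + w2 * (w2 * 1)))).
  { rewrite <- Ea, <- Ew. apply Rmult_le_pos; nra. }
  lra.
Qed.

(* A disk automorphism (vanishing at [a]) times a power of the Cauchy kernel; the exponent
   [m] is kept an integer so that no complex power function is required. *)
Definition test_fun (alpha : R) (m : nat) (a w : C) : C :=
  ((w - a) * (RtoC (Rpower (1 - Cmod a ^ 2) (INR m - alpha)) / (1 - Cconj a * w) ^ S m))%C.

Lemma one_minus_conj_neq_0 (a w : C) :
  Cmod a < 1 -> Cmod w < 1 -> (1 - Cconj a * w)%C <> RtoC 0.
Proof. intros Ha Hw. exact (Cmod_pos_neq_0 _ (proj1 (Cmod_one_minus_conj a w Ha Hw))). Qed.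

(** Existence suffices: in the product rule at w = a this derivative is multiplied by w - a = 0. *)
Lemma test_fun_factor_derive (alpha : R) (m : nat) (a w : C) :
  Cmod a < 1 -> Cmod w < 1 ->
  exists d, Cderiv (fun w => RtoC (Rpower (1 - Cmod a ^ 2) (INR m - alpha))
                             / (1 - Cconj a * w) ^ S m)%C w d.
Proof.
  intros Ha Hw.
  destruct (Cderiv_pow_ex (fun w => 1 - Cconj a * w)%C w
    (0 - (0 * w + Cconj a * 1))%C (S m)) as [e He].
  { apply (Cderiv_minus (fun _ => RtoC 1) (fun w => Cconj a * w)%C); [apply Cderiv_const|].
    apply (Cderiv_mult (fun _ => Cconj a) (fun w => w)); [apply Cderiv_const | apply Cderiv_id]. }
  apply (Cderiv_div (fun _ => RtoC _) (fun w => (1 - Cconj a * w) ^ S m)%C w (RtoC 0) e);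
    [|apply Cderiv_const|exact He].
  apply Cpow_nz. now apply one_minus_conj_neq_0.
Qed.

Lemma test_fun_HD (alpha : R) (m : nat) (a : C) : Cmod a < 1 -> HD (test_fun alpha m a).
Proof.
  intros Ha w Hw. apply inD_Cmod in Hw.
  destruct (test_fun_factor_derive alpha m a w Ha Hw) as [d Hd].
  eexists. unfold test_fun. apply Cderiv_mult; [|exact Hd].
  apply Cderiv_minus; [apply Cderiv_id | apply Cderiv_const].
Qed.

(** At w = a the kernel 1 - conj(a) w equals x = 1 - |a|^2, and the product rule leaves x^(m -
    alpha) / x^(m + 1). *)
Lemma test_fun_derive (alpha : R) (m : nat) (a d : C) :
  Cmod a < 1 -> Cderiv (test_fun alpha m a) a d ->
  Cmod d = Rpower (1 - Cmod a ^ 2) (- (alpha + 1)).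
Proof.
  intros Ha Hd.
  destruct (test_fun_factor_derive alpha m a a Ha Ha) as [e He].
  assert (H := Cderiv_mult (fun w => w - a)%C _ a _ _
    (Cderiv_minus _ _ _ _ _ (Cderiv_id a) (Cderiv_const a a)) He).
  rewrite (Cderiv_unique _ _ _ _ Hd H). clear H He Hd.
  assert (Hx := disk_weight_pos a Ha).
  assert (E : (1 - Cconj a * a)%C = RtoC (1 - Cmod a ^ 2)).
  { rewrite RtoC_minus, Cmod2_conj. ring. }
  rewrite E.
  set (x := 1 - Cmod a ^ 2) in *.
  replace ((1 - 0) * (Rpower x (INR m - alpha) / x ^ S m) + (a - a) * e)%C
    with (Rpower x (INR m - alpha) / RtoC x ^ S m)%C by ring.
  assert (Nx : RtoC x <> RtoC 0) by (apply Cmod_pos_neq_0; rewrite Cmod_R, Rabs_pos_eq; lra).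
  rewrite Cmod_div by now apply Cpow_nz.
  rewrite Cmod_pow, !Cmod_R, !Rabs_pos_eq by (try (left; apply Rpower_pos); lra).
  rewrite <- Rpower_pow by auto. unfold Rdiv. rewrite <- Rpower_Ropp, <- Rpower_plus.
  f_equal. rewrite S_INR. ring.
Qed.

(** The factor |w - a| cancels one power of X = |1 - conj(a) w|. Both 1 - |a|^2 and 1 - |w|^2 are at
    most 2 X, and their exponents m - alpha and alpha are nonnegative with sum m, so their product
    is at most (2 X)^m. *)
Lemma test_fun_bound (alpha : R) (m : nat) (a : C) :
  Cmod a < 1 -> 0 <= alpha <= INR m -> Hinf_bound alpha (test_fun alpha m a) (2 ^ m).
Proof.
  intros Ha Hal. apply Hinf_bound_Cmod. intros w Hw.
  destruct (Cmod_one_minus_conj a w Ha Hw) as (HX & H1 & H2 & H3).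
  assert (Hx := disk_weight_pos a Ha). assert (Hy := disk_weight_pos w Hw).
  assert (Nz := one_minus_conj_neq_0 a w Ha Hw).
  unfold test_fun. rewrite Cmod_mult, Cmod_div by now apply Cpow_nz.
  rewrite Cmod_pow, Cmod_R, Rabs_pos_eq by (left; apply Rpower_pos).
  set (X := Cmod (1 - Cconj a * w)%C) in *.
  set (x := 1 - Cmod a ^ 2) in *. set (y := 1 - Cmod w ^ 2) in *.
  assert (HXm : 0 < X ^ m) by now apply pow_lt.
  assert (P : Rpower y alpha * Rpower x (INR m - alpha) <= 2 ^ m * X ^ m).
  { rewrite <- Rpow_mult_distr, <- Rpower_pow by lra.
    replace (INR m) with (alpha + (INR m - alpha)) at 2 by ring. rewrite Rpower_plus.
    apply Rmult_le_compat; try (left; apply Rpower_pos); apply Rle_Rpower_l; lra. }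
  simpl (X ^ S m).
  apply Rle_trans with (Rpower y alpha * (X * (Rpower x (INR m - alpha) / (X * X ^ m)))).
  { apply Rmult_le_compat_l; [left; apply Rpower_pos|]. apply Rmult_le_compat_r; auto.
    left. apply Rdiv_lt_0_compat; [apply Rpower_pos|]. now apply Rmult_lt_0_compat. }
  replace (Rpower y alpha * (X * (Rpower x (INR m - alpha) / (X * X ^ m))))
    with (Rpower y alpha * Rpower x (INR m - alpha) / X ^ m) by (field; lra).
  apply Rmult_le_reg_r with (X ^ m); auto.
  replace (Rpower y alpha * Rpower x (INR m - alpha) / X ^ m * X ^ m)
    with (Rpower y alpha * Rpower x (INR m - alpha)) by (field; lra).
  exact P.
Qed.

(** [Sg_bounded] speaks only of those [F] related to f by [Sg]; to apply it to a test function, such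
    an [F] has to be produced. *)
Lemma Sg_exists (g f : C -> C) : HD g -> HD f -> exists F, Sg g f F.
Proof.
  intros Hg Hf.
  pose (fp := fun w : C => epsilon (inhabits (RtoC 0)) (fun d : C => Cderiv f w d)).
  assert (Hfp : forall w, inD w -> Cderiv f w (fp w)).
  { intros w Hw. apply (epsilon_spec (inhabits (RtoC 0)) (fun d : C => Cderiv f w d)). now apply Hf. }
  exists (fun z => CI (fun t => fp (t * z) * g (t * z) * z)%C 0 1), fp. split; auto.
  intros z Hz. apply seg_int_cint, CI_correct01. intros t Ht.
  apply (HD_ccont_ray (fun w => fp w * g w)%C); auto; [|now apply inD_Cmod].
  apply HD_mult; auto. now apply (HD_derivative f).
Qed.

Theorem theorem3 (g : Cpx -> Cpx) (alpha beta : R)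
  (hg : HD g) (halpha : 0 <= alpha) (hbeta : 0 < beta) :
  Sg_bounded g alpha beta <->
  exists M : R, forall z : Cpx, inD z ->
    Rpower (1 - Cnorm z ^ 2) (beta - alpha) * Cnorm (g z) <= M.
Proof.
  split.
  - intros [K HK].
    (* One [m] above alpha serves all points a, so the bound 2^m on the test functions is uniform in
       a. *)
    destruct (INR_unbounded alpha) as [m Hm].
    exists (4 * Rpower 4 beta * (K * 2 ^ m)). intros a Ha. rewrite Cnorm_Cmod, Cnorm_Cmod.
    assert (Ha' := proj1 (inD_Cmod a) Ha).
    assert (Hf := test_fun_HD alpha m a Ha').
    assert (HN := test_fun_bound alpha m a Ha' ltac:(lra)).
    destruct (Sg_exists g _ hg Hf) as [F HF].
    destruct (HK _ (conj Hf (ex_intro _ _ HN)) F HF) as [HDF HB].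
    destruct HF as (fp & Hfp & HFI).
    assert (D := Sg_derive g (test_fun alpha m a) F fp a hg (HD_derivative _ _ Hf Hfp) HFI Ha).
    assert (E := Hinf_derivative_bound F beta _ a _ HDF (Rlt_le _ _ hbeta) (HB _ HN) Ha' D).
    rewrite Cmod_mult, (test_fun_derive alpha m a _ Ha' (Hfp a Ha)) in E.
    eapply Rle_trans; [right|exact E].
    (* The first exponent is the size of the test function's derivative at a, the second the weight
       in the derivative estimate for [F]. *)
    replace (beta - alpha) with (- (alpha + 1) + (beta + 1)) by ring.
    rewrite Rpower_plus. ring.
  - intros [M HM].
    (* The constant of the ray integration, times that of the derivative estimate for f, times the
       bound on g. *)
    exists (Rpower 2 beta / beta * (4 * Rpower 4 alpha * M)).
    intros f [Hf _] F (fp & Hfp & HF).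
    assert (HDfp := HD_derivative f fp Hf Hfp).
    split.
    + intros z Hz. eexists. now apply (Sg_derive g f F fp z).
    + intros N HN. apply Hinf_bound_Cmod. intros z Hz.
      replace (Rpower 2 beta / beta * (4 * Rpower 4 alpha * M) * N)
        with (Rpower 2 beta / beta * ((4 * Rpower 4 alpha * N) * M)) by ring.
      apply (ray_integral_growth (fun w => fp w * g w)%C z); auto.
      * intros w Hw.
        assert (Hw' := proj2 (inD_Cmod w) Hw).
        assert (E := Hinf_derivative_bound f alpha N w _ Hf halpha HN Hw (Hfp w Hw')).
        assert (G := HM w Hw'). rewrite !Cnorm_Cmod in G.
        rewrite Cmod_mult.
        (* The weight required for the integrand splits into the one controlling f' and the one
           controlling g. *)
        replace (beta + 1) with ((alpha + 1) + (beta - alpha)) by ring. rewrite Rpower_plus.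
        set (x := 1 - Cmod w ^ 2) in *.
        replace (Cmod (fp w) * Cmod (g w) * (Rpower x (alpha + 1) * Rpower x (beta - alpha)))
          with ((Cmod (fp w) * Rpower x (alpha + 1)) * (Rpower x (beta - alpha) * Cmod (g w))) by ring.
        apply Rmult_le_compat; auto; apply Rmult_le_pos; try apply Cmod_ge_0; left; apply Rpower_pos.
      * apply (seg_int_cint (fun w => fp w * g w)%C). now apply HF, inD_Cmod.
Qed.
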